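(* An arithmetical formula $\varphi$ is provable in Peano arithmetic $\mathrm{PA}$ if and only if $\varphi$ (i.e. the sequent $\{\varphi\}$) has a regular $\infty$-proof.
   Context: **Formulas and sequents.** Arithmetical terms are built from individual variables $\mathit{Var}=\{x_0,x_1,\dots\}$ and the constant $0$ by the unary symbol $s$ and the binary symbols $+,\cdot$. Arithmetical formulas are given by $\varphi::=t=t\mid t\neq t\mid(\varphi\wedge\varphi)\mid(\varphi\vee\varphi)\mid\forall y\,\varphi\mid\exists y\,\varphi$. Negation $\overline{\varphi}$ is the syntactic operation swapping $=$ with $\neq$, $\wedge$ with $\vee$, $\forall$ with $\exists$ (so $\overline{\overline\varphi}=\varphi$). Put $\bot:=0\neq 0$, $\varphi\to\psi:=\overline\varphi\vee\psi$. $\varphi[y\mapsto t]$ is the substitution of $t$ for all free occurrences of $y$ (no variable of $t$ may become bound). A sequent is a finite multiset of formulas, interpreted as $\bigvee\Gamma$ (with $\bigvee\emptyset:=\bot$); the comma denotes multiset union. $\mathit{FV}$ denotes the set of free variables. **Theories.** Robinson's arithmetic $\mathsf{Q}$: first-order logic with equality plus (universal closures of) $\neg s(x)=0$; $s(x)=s(y)\to x=y$; $x=0\vee\exists y\,x=s(y)$; $x+0=x$; $x+s(y)=s(x+y)$; $x\cdot0=0$; $x\cdot s(y)=x\cdot y+x$. $\mathrm{PA}$ is $\mathsf{Q}$ plus the induction schema $\varphi(0)\wedge\forall x(\varphi(x)\to\varphi(s(x)))\to\forall x\,\varphi(x)$ for all formulas $\varphi$ (possibly with other free variables). **Calculus $\mathsf{SQ}$.**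 Initial sequents: $\Gamma,t_0=t_1,t_0\neq t_1$ and $\Gamma,s(t)\neq0$. Rules (premisses / conclusion): $(\wedge)$: $\Gamma,\varphi$ and $\Gamma,\psi$ / $\Gamma,\varphi\wedge\psi$; $(\vee)$: $\Gamma,\varphi,\psi$ / $\Gamma,\varphi\vee\psi$; $(\forall)$: $\Gamma,\varphi[y\mapsto z]$ / $\Gamma,\forall y\,\varphi$, where $z\notin\mathit{FV}(\Gamma,\forall y\,\varphi)$ ($z$ is the active variable); $(\exists)$: $\Gamma,\varphi[y\mapsto t],\exists y\,\varphi$ / $\Gamma,\exists y\,\varphi$; $(\mathsf{ref})$: $\Gamma,t\neq t$ / $\Gamma$; $(\mathsf{rep})$: $\Gamma,t_0\neq t_1,(u_0\neq u_1)[y\mapsto t_0],(u_0\neq u_1)[y\mapsto t_1]$ / $\Gamma,t_0\neq t_1,(u_0\neq u_1)[y\mapsto t_0]$; $(\mathsf{add}_0)$: $\Gamma,t+0\neq t$ / $\Gamma$; $(\mathsf{add}_s)$: $\Gamma,t+s(u)\neq s(t+u)$ / $\Gamma$; $(\mathsf{mult}_0)$: $\Gamma,t\cdot0\neq0$ / $\Gamma$; $(\mathsf{mult}_s)$: $\Gamma,t\cdot s(u)\neq t\cdot u+t$ / $\Gamma$; $(\mathsf{pred})$: $\Gamma,s(t_0)\neq s(t_1),t_0\neq t_1$ / $\Gamma,s(t_0)\neq s(t_1)$; $(\mathsf{case})$: left premiss $\Gamma[y\mapsto0]$ and right premiss $\Gamma[y\mapsto s(y)]$ / $\Gamma$, where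 $y\in\mathit{FV}(\Gamma)$ ($y$ is the active variable); $(\mathsf{weak})$: $\Gamma$ / $\Gamma,\Delta$; $(\mathsf{cut})$: left premiss $\Gamma,\varphi$ and right premiss $\Gamma,\overline\varphi$ / $\Gamma$. **$\infty$-proofs.** An (unrestricted) $\infty$-proof is a possibly infinite tree whose nodes are marked by sequents, constructed according to the rules of $\mathsf{SQ}$, with every leaf marked by an initial sequent, such that every infinite branch has a tail satisfying: (a) the tail does not pass through left premisses of $(\mathsf{case})$; (b) if the tail passes through the right premiss $\Gamma[z\mapsto s(z)]$ of $(\mathsf{case})$, then after that application the tail does not intersect applications of $(\forall)$ with active variable $z$; (c) for some variable $y$, the tail passes through the right premiss of $(\mathsf{case})$ with active variable $y$ infinitely many times. An $\infty$-proof is regular if it contains only finitely many non-isomorphic subtrees with respect to the marking of sequents. *)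

(* Defs.v *)
From HB Require Import structures.
From mathcomp Require Import all_boot.
From mathcomp Require Import finmap multiset.

Set Implicit Arguments.
Unset Strict Implicit.
Unset Printing Implicit Defensive.

Open Scope mset_scope.

(* The variable x_i is represented by its index i. *)
Inductive term : Type :=
| Var of nat
| Zero
| Succ of term
| Plus of term & term
| Mult of term & term.

Inductive formula : Type :=
| Eq of term & term
| Neq of term & term
| And of formula & formula
| Or of formula & formula
| All of nat & formula
| Ex of nat & formula.

(* Multisets over formulas require a choiceType: both syntactic types are
   encoded in generic trees. *)
Fixpoint term_enc (t : term) : GenTree.tree nat :=
  match t with
  | Var x => GenTree.Leaf x
  | Zero => GenTree.Node 0 [::]
  | Succ t => GenTree.Node 1 [:: term_enc t]
  | Plus t u => GenTree.Node 2 [:: term_enc t; term_enc u]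
  | Mult t u => GenTree.Node 3 [:: term_enc t; term_enc u]
  end.

Fixpoint term_dec (e : GenTree.tree nat) : term :=
  match e with
  | GenTree.Leaf x => Var x
  | GenTree.Node 1 [:: e1] => Succ (term_dec e1)
  | GenTree.Node 2 [:: e1; e2] => Plus (term_dec e1) (term_dec e2)
  | GenTree.Node 3 [:: e1; e2] => Mult (term_dec e1) (term_dec e2)
  | _ => Zero
  end.

Lemma term_encK : cancel term_enc term_dec.
Proof. by elim=> //= [t ->|t -> u ->|t -> u ->]. Qed.

HB.instance Definition _ := Countable.copy term (can_type term_encK).

Fixpoint formula_enc (f : formula) : GenTree.tree (term * term + nat) :=
  match f with
  | Eq t u => GenTree.Node 0 [:: GenTree.Leaf (inl (t, u))]
  | Neq t u => GenTree.Node 1 [:: GenTree.Leaf (inl (t, u))]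
  | And f g => GenTree.Node 2 [:: formula_enc f; formula_enc g]
  | Or f g => GenTree.Node 3 [:: formula_enc f; formula_enc g]
  | All y f => GenTree.Node 4 [:: GenTree.Leaf (inr y); formula_enc f]
  | Ex y f => GenTree.Node 5 [:: GenTree.Leaf (inr y); formula_enc f]
  end.

Fixpoint formula_dec (e : GenTree.tree (term * term + nat)) : formula :=
  match e with
  | GenTree.Node 0 [:: GenTree.Leaf (inl (t, u))] => Eq t u
  | GenTree.Node 1 [:: GenTree.Leaf (inl (t, u))] => Neq t u
  | GenTree.Node 2 [:: e1; e2] => And (formula_dec e1) (formula_dec e2)
  | GenTree.Node 3 [:: e1; e2] => Or (formula_dec e1) (formula_dec e2)
  | GenTree.Node 4 [:: GenTree.Leaf (inr y); e1] => All y (formula_dec e1)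
  | GenTree.Node 5 [:: GenTree.Leaf (inr y); e1] => Ex y (formula_dec e1)
  | _ => Eq Zero Zero
  end.

Lemma formula_encK : cancel formula_enc formula_dec.
Proof. by elim=> //= [f -> g ->|f -> g ->|y f ->|y f ->]. Qed.

HB.instance Definition _ := Countable.copy formula (can_type formula_encK).

Fixpoint neg (f : formula) : formula :=
  match f with
  | Eq t u => Neq t u
  | Neq t u => Eq t u
  | And f g => Or (neg f) (neg g)
  | Or f g => And (neg f) (neg g)
  | All y f => Ex y (neg f)
  | Ex y f => All y (neg f)
  end.

Definition imp (f g : formula) : formula := Or (neg f) g.

Fixpoint tfv (t : term) : seq nat :=
  match t with
  | Var x => [:: x]
  | Zero => [::]
  | Succ t => tfv t
  | Plus t u | Mult t u => tfv t ++ tfv u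
  end.

Fixpoint fv (f : formula) : seq nat :=
  match f with
  | Eq t u | Neq t u => tfv t ++ tfv u
  | And f g | Or f g => fv f ++ fv g
  | All y f | Ex y f => filter (predC1 y) (fv f)
  end.

Fixpoint tsubst (y : nat) (t : term) (u : term) : term :=
  match u with
  | Var x => if x == y then t else Var x
  | Zero => Zero
  | Succ u => Succ (tsubst y t u)
  | Plus u v => Plus (tsubst y t u) (tsubst y t v)
  | Mult u v => Mult (tsubst y t u) (tsubst y t v)
  end.

(* [subst y t f] is f[y |-> t]. It does not rename bound variables, so it is
   meaningful only together with [free_for y t f]: no variable of t becomes
   bound. *)
Fixpoint subst (y : nat) (t : term) (f : formula) : formula :=
  match f with
  | Eq u v => Eq (tsubst y t u) (tsubst y t v)
  | Neq u v => Neq (tsubst y t u) (tsubst y t v)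
  | And f g => And (subst y t f) (subst y t g)
  | Or f g => Or (subst y t f) (subst y t g)
  | All x f => All x (if x == y then f else subst y t f)
  | Ex x f => Ex x (if x == y then f else subst y t f)
  end.

Fixpoint free_for (y : nat) (t : term) (f : formula) : bool :=
  match f with
  | Eq _ _ | Neq _ _ => true
  | And f g | Or f g => free_for y t f && free_for y t g
  | All x g | Ex x g =>
      (y \notin fv f) || (x \notin tfv t) && free_for y t g
  end.

(* The substitutions y |-> 0 and y |-> s(y), used in the rule (case) and in
   the induction schema, never capture. *)
Lemma free_for_self (y : nat) (t : term) (f : formula) :
  {subset tfv t <= [:: y]} -> free_for y t f.
Proof.
move=> tP; elim: f => //= [f -> g ->|f -> g ->|x f ->|x f ->] //;
  rewrite andbT mem_filter /= negb_and negbK;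
  case: eqVneq => //= yx; apply/orP; right;
  by apply/negP => /tP; rewrite inE eq_sym (negPf yx).
Qed.

Definition uclosure (f : formula) : formula := foldr All f (undup (fv f)).

Definition sequent := {mset formula}.

Definition in_fv (y : nat) (G : sequent) : Prop :=
  exists2 f, f \in G & y \in fv f.

Definition ssubst (y : nat) (t : term) (G : sequent) : sequent :=
  seq_mset [seq subst y t f | f <- enum_mset G].

(* One-sided (Tait-style) sequent calculus with cut for classical first-order
   logic with equality; [FOL T G] means that the disjunction of G is derivable
   from the sentences in T. Replacement of equals is postulated for atomic
   formulas. *)
Inductive FOL (T : formula -> Prop) : sequent -> Prop :=
| FOL_thy G f : T f -> FOL T (f +` G)
| FOL_id G f : FOL T (f +` (neg f +` G))
| FOL_refl G t : FOL T (Eq t t +` G)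
| FOL_repl G y t0 t1 u0 u1 :
    FOL T (Neq t0 t1 +` (neg (subst y t0 (Eq u0 u1))
                      +` (subst y t1 (Eq u0 u1) +` G)))
| FOL_and G f g : FOL T (f +` G) -> FOL T (g +` G) -> FOL T (And f g +` G)
| FOL_or G f g : FOL T (f +` (g +` G)) -> FOL T (Or f g +` G)
| FOL_all G y z f :
    ~ in_fv z (All y f +` G) -> free_for y (Var z) f ->
    FOL T (subst y (Var z) f +` G) -> FOL T (All y f +` G)
| FOL_ex G y t f :
    free_for y t f -> FOL T (subst y t f +` G) -> FOL T (Ex y f +` G)
| FOL_weak G D : FOL T G -> FOL T (G `+` D)
| FOL_contr G f : FOL T (f +` (f +` G)) -> FOL T (f +` G)
| FOL_cut G f : FOL T (f +` G) -> FOL T (neg f +` G) -> FOL T G.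

Definition provable (T : formula -> Prop) (f : formula) : Prop :=
  FOL T [mset f].

Definition Q_matrices : seq formula :=
  let x := Var 0 in
  let y := Var 1 in
  [:: Neq (Succ x) Zero;
      imp (Eq (Succ x) (Succ y)) (Eq x y);
      Or (Eq x Zero) (Ex 1 (Eq x (Succ y)));
      Eq (Plus x Zero) x;
      Eq (Plus x (Succ y)) (Succ (Plus x y));
      Eq (Mult x Zero) Zero;
      Eq (Mult x (Succ y)) (Plus (Mult x y) x)].

Definition induction_axiom (x : nat) (f : formula) : formula :=
  imp (And (subst x Zero f) (All x (imp f (subst x (Succ (Var x)) f))))
      (All x f).

Inductive PA : formula -> Prop :=
| PA_robinson f : f \in Q_matrices -> PA (uclosure f)
| PA_induction x f : PA (uclosure (induction_axiom x f)).

(* Names of rule applications; (forall) and (case) carry their active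
   variable. *)
Inductive rule : Type :=
| Init | RAnd | ROr | RAll of nat | REx | Ref | Rep | Add0 | AddS
| Mult0 | MultS | Pred | Case of nat | Weak | Cut.

(* [SQ r ps G]: G follows from the list of premisses ps, in left-to-right
   order, by an application of r. *)
Inductive SQ : rule -> seq sequent -> sequent -> Prop :=
| SQ_init_eq G t0 t1 : SQ Init [::] (Eq t0 t1 +` (Neq t0 t1 +` G))
| SQ_init_succ G t : SQ Init [::] (Neq (Succ t) Zero +` G)
| SQ_and G f g : SQ RAnd [:: f +` G; g +` G] (And f g +` G)
| SQ_or G f g : SQ ROr [:: f +` (g +` G)] (Or f g +` G)
| SQ_all G y z f :
    ~ in_fv z (All y f +` G) -> free_for y (Var z) f ->
    SQ (RAll z) [:: subst y (Var z) f +` G] (All y f +` G)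
| SQ_ex G y t f :
    free_for y t f ->
    SQ REx [:: subst y t f +` (Ex y f +` G)] (Ex y f +` G)
| SQ_ref G t : SQ Ref [:: Neq t t +` G] G
| SQ_rep G y t0 t1 u0 u1 :
    SQ Rep [:: Neq t0 t1 +` (subst y t0 (Neq u0 u1)
                          +` (subst y t1 (Neq u0 u1) +` G))]
           (Neq t0 t1 +` (subst y t0 (Neq u0 u1) +` G))
| SQ_add0 G t : SQ Add0 [:: Neq (Plus t Zero) t +` G] G
| SQ_addS G t u :
    SQ AddS [:: Neq (Plus t (Succ u)) (Succ (Plus t u)) +` G] G
| SQ_mult0 G t : SQ Mult0 [:: Neq (Mult t Zero) Zero +` G] G
| SQ_multS G t u :
    SQ MultS [:: Neq (Mult t (Succ u)) (Plus (Mult t u) t) +` G] G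
| SQ_pred G t0 t1 :
    SQ Pred [:: Neq (Succ t0) (Succ t1) +` (Neq t0 t1 +` G)]
            (Neq (Succ t0) (Succ t1) +` G)
| SQ_case G y :
    in_fv y G ->
    SQ (Case y) [:: ssubst y Zero G; ssubst y (Succ (Var y)) G] G
| SQ_weak G D : SQ Weak [:: G] (G `+` D)
| SQ_cut G f : SQ Cut [:: f +` G; neg f +` G] G.

(* A possibly infinite tree is a partial function on addresses. The root has
   address [::], and [rcons a i] is the address of the i-th premiss (counted
   from 0) of the node a. Besides its sequent, a node records the rule of which
   it is the conclusion. *)
Definition tree := seq nat -> option (sequent * rule).

Definition sequent_at (P : tree) (a : seq nat) : option sequent :=
  omap fst (P a).

Definition rule_at (P : tree) (a : seq nat) : option rule := omap snd (P a).

(* [Init] is the only rule without premisses, so local correctness forces the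
   leaves to be initial sequents. *)
Definition locally_correct (P : tree) : Prop :=
  forall a,
    match P a with
    | Some (G, r) =>
        exists2 ps, SQ r ps G & forall i, sequent_at P (rcons a i) = onth ps i
    | None => forall i, P (rcons a i) = None
    end.

(* An infinite branch is given by the premiss b n chosen at each step n; its
   n-th node has address b 0, ..., b (n - 1). *)
Definition infinite_branch (P : tree) (b : nat -> nat) : Prop :=
  forall n, P (mkseq b n) <> None.

Definition left_case_at (P : tree) (b : nat -> nat) (y n : nat) : Prop :=
  rule_at P (mkseq b n) = Some (Case y) /\ b n = 0.

Definition right_case_at (P : tree) (b : nat -> nat) (y n : nat) : Prop :=
  rule_at P (mkseq b n) = Some (Case y) /\ b n = 1.

Definition good_tail (P : tree) (b : nat -> nat) (N : nat) : Prop :=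
  [/\ forall n y, N <= n -> ~ left_case_at P b y n,
      forall m n z, N <= m -> m < n -> right_case_at P b z m ->
        rule_at P (mkseq b n) <> Some (RAll z)
    & exists y, forall M, exists2 n, maxn M N <= n & right_case_at P b y n].

Definition infty_proof (P : tree) (G : sequent) : Prop :=
  [/\ sequent_at P [::] = Some G,
      locally_correct P
    & forall b, infinite_branch P b -> exists N, good_tail P b N].

(* Isomorphism of the subtrees rooted at a and b; only the marking by sequents
   is compared, not the rules. *)
Definition subtree_iso (P : tree) (a b : seq nat) : Prop :=
  forall c, sequent_at P (a ++ c) = sequent_at P (b ++ c).

Definition regular (P : tree) : Prop :=
  exists reps : seq (seq nat),
    forall a, P a <> None -> exists2 b, b \in reps & subtree_iso P a b.

(* Main.v *)
(** From left to right, the calculus SQ simulates a derivation in PA rule by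
    rule; contraction is a cut against an identity, and induction on x is the
    cycle that unfolds f(x) by (case) and discharges f(s(x)) by the step.

    From right to left, provability in PA is reduced by completeness to
    truth in every model of PA. A regular proof is a finite graph whose nodes
    are classes of isomorphic subtrees. A node falsified by a valuation has a
    falsified successor, and the valuation changes only at a non-vacuous
    (forall) or at a right premiss of (case), where the active variable
    decreases. In a terminal strongly connected component of falsified nodes, a
    closed walk through all nodes is an infinite branch, so some variable y is
    decreased on the component and never reset there. By induction in the
    model, choose for y a value whose predecessor does not occur at any
    falsified node of the component. With y fixed at this value the right
    (case) edges of y are never taken, and the argument is repeated on the
    smaller graph until no (case) edge is left. *)

Require Import Defs.
From mathcomp Require Import all_boot.
From mathcomp Require Import finmap multiset.
From mathcomp Require Import zify.
From mathcomp Require Import boolp.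

Set Implicit Arguments.
Unset Strict Implicit.
Unset Printing Implicit Defensive.

Local Open Scope mset_scope.
Local Open Scope nat_scope.

(** * Syntax *)

Lemma negK : involutive neg.
Proof. by elim=> //= [f -> g ->|f -> g ->|y f ->|y f ->]. Qed.

Lemma fv_neg f : fv (neg f) = fv f.
Proof. by elim: f => //= [f -> g ->|f -> g ->|y f ->|y f ->]. Qed.

Lemma neg_subst y t f : neg (subst y t f) = subst y t (neg f).
Proof.
by elim: f => //= [f -> g ->|f -> g ->|x f IH|x f IH] //; case: eqP; rewrite ?IH.
Qed.

Lemma free_for_neg y t f : free_for y t (neg f) = free_for y t f.
Proof.
by elim: f => //= [f -> g ->|f -> g ->|x f ->|x f ->] //; rewrite fv_neg.
Qed.

Lemma tsubst_id y t u : y \notin tfv u -> tsubst y t u = u.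
Proof.
elim: u => //= [x|u IH /IH->|u IHu v IHv|u IHu v IHv] //.
- by rewrite inE eq_sym => /negPf->.
- by rewrite mem_cat negb_or => /andP[/IHu-> /IHv->].
- by rewrite mem_cat negb_or => /andP[/IHu-> /IHv->].
Qed.

Lemma subst_id y t f : y \notin fv f -> subst y t f = f.
Proof.
elim: f => /= [u v|u v|f IHf g IHg|f IHf g IHg|x f IH|x f IH];
  rewrite ?mem_cat ?negb_or ?mem_filter /= 1?negb_and ?negbK.
- by case/andP=> /tsubst_id-> /tsubst_id->.
- by case/andP=> /tsubst_id-> /tsubst_id->.
- by case/andP=> /IHf-> /IHg->.
- by case/andP=> /IHf-> /IHg->.
- by rewrite eq_sym; case: eqP => //= _ /IH->.
- by rewrite eq_sym; case: eqP => //= _ /IH->.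
Qed.

Lemma tsubst_var y u : tsubst y (Var y) u = u.
Proof. by elim: u => //= [x|u ->|u -> v ->|u -> v ->] //; case: eqP => [->|]. Qed.

Lemma subst_var y f : subst y (Var y) f = f.
Proof.
elim: f => //= [u v|u v|f -> g ->|f -> g ->|x f ->|x f ->] //;
  by rewrite ?tsubst_var // if_same.
Qed.

Lemma tfv_subst_closed y t u : tfv t = [::] -> y \notin tfv (tsubst y t u).
Proof.
move=> t0; elim: u => //= [x|u IHu v IHv|u IHu v IHv];
  rewrite ?mem_cat ?negb_or ?IHu ?IHv //.
by case: (eqVneq x y) => [|xy]; rewrite ?t0 //= inE eq_sym.
Qed.

Lemma fv_subst_closed y t f : tfv t = [::] -> y \notin fv (subst y t f).
Proof.
move=> t0.
elim: f => /= [u v|u v|f IHf g IHg|f IHf g IHg|x f IH|x f IH];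
  rewrite ?mem_cat ?negb_or ?tfv_subst_closed ?IHf ?IHg // mem_filter negb_and /=;
  by rewrite eq_sym; case: (eqVneq x y).
Qed.

Lemma mem_tfv_subst x y t u : x != y -> x \in tfv u -> x \in tfv (tsubst y t u).
Proof.
move=> xy; elim: u => //= [z|u IHu v IHv|u IHu v IHv].
- by rewrite inE => /eqP<-; rewrite (negPf xy) /= inE.
- by rewrite !mem_cat => /orP[/IHu->|/IHv->]; rewrite ?orbT.
- by rewrite !mem_cat => /orP[/IHu->|/IHv->]; rewrite ?orbT.
Qed.

Lemma mem_fv_subst x y t f : x != y -> x \in fv f -> x \in fv (subst y t f).
Proof.
move=> xy; elim: f => /= [u v|u v|f IHf g IHg|f IHf g IHg|z f IH|z f IH].
- by rewrite !mem_cat => /orP[]/mem_tfv_subst->; rewrite ?orbT.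
- by rewrite !mem_cat => /orP[]/mem_tfv_subst->; rewrite ?orbT.
- by rewrite !mem_cat => /orP[/IHf->|/IHg->]; rewrite ?orbT.
- by rewrite !mem_cat => /orP[/IHf->|/IHg->]; rewrite ?orbT.
- by rewrite !mem_filter => /andP[->] xf; case: eqP => //= _; apply: IH.
- by rewrite !mem_filter => /andP[->] xf; case: eqP => //= _; apply: IH.
Qed.

Lemma tfv_substS x y t u :
  x \in tfv (tsubst y t u) -> (x \in tfv t) || (x != y) && (x \in tfv u).
Proof.
elim: u => //= [z|u IHu v IHv|u IHu v IHv].
- by case: (eqVneq z y) => [_ ->//|zy]; rewrite /= !inE => /eqP->; rewrite zy eqxx orbT.
- by rewrite !mem_cat => /orP[/IHu|/IHv] /orP[->//|/andP[->->]]; rewrite ?orbT.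
- by rewrite !mem_cat => /orP[/IHu|/IHv] /orP[->//|/andP[->->]]; rewrite ?orbT.
Qed.

Lemma fv_substS x y t f :
  x \in fv (subst y t f) -> (x \in tfv t) || (x != y) && (x \in fv f).
Proof.
elim: f => /= [u v|u v|f IHf g IHg|f IHf g IHg|z f IH|z f IH].
- by rewrite !mem_cat => /orP[]/tfv_substS/orP[->//|/andP[->->]]; rewrite ?orbT.
- by rewrite !mem_cat => /orP[]/tfv_substS/orP[->//|/andP[->->]]; rewrite ?orbT.
- by rewrite !mem_cat => /orP[/IHf|/IHg]/orP[->//|/andP[->->]]; rewrite ?orbT.
- by rewrite !mem_cat => /orP[/IHf|/IHg]/orP[->//|/andP[->->]]; rewrite ?orbT.
- rewrite !mem_filter /= => /andP[xz]; rewrite xz /=.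
  by case: (eqVneq z y) => [<- ->|_ /IH]; rewrite ?xz ?orbT.
- rewrite !mem_filter /= => /andP[xz]; rewrite xz /=.
  by case: (eqVneq z y) => [<- ->|_ /IH]; rewrite ?xz ?orbT.
Qed.

(** Terms do not count, so an induction on this measure passes from a quantified formula to all its
    instances. *)
Fixpoint fsize (f : formula) : nat :=
  match f with
  | Eq _ _ | Neq _ _ => 0
  | And f g | Or f g => (fsize f + fsize g).+1
  | All _ f | Ex _ f => (fsize f).+1
  end.

Lemma fsize_subst y t f : fsize (subst y t f) = fsize f.
Proof.
by elim: f => //= [f -> g ->|f -> g ->|x f IH|x f IH] //; case: eqP; rewrite ?IH.
Qed.

Lemma fsize_neg f : fsize (neg f) = fsize f.
Proof. by elim: f => //= [f -> g ->|f -> g ->|x f ->|x f ->]. Qed.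

Fixpoint tbound (t : term) : nat :=
  match t with
  | Var x => x.+1
  | Zero => 0
  | Succ t => tbound t
  | Plus t u | Mult t u => maxn (tbound t) (tbound u)
  end.

(** Bound variables count too: a variable from [fbound f] on is at once fresh for [f] and free for
    substitution in it. *)
Fixpoint fbound (f : formula) : nat :=
  match f with
  | Eq t u | Neq t u => maxn (tbound t) (tbound u)
  | And f g | Or f g => maxn (fbound f) (fbound g)
  | All x f | Ex x f => maxn x.+1 (fbound f)
  end.

Definition sbound (G : sequent) : nat := \max_(f <- enum_mset G) fbound f.

Lemma tbound_fv x t : x \in tfv t -> x < tbound t.
Proof.
elim: t => //= [y|t IHt u IHu|t IHt u IHu]; first by rewrite inE => /eqP->.
- by rewrite mem_cat leq_max => /orP[/IHt->|/IHu->]; rewrite ?orbT.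
- by rewrite mem_cat leq_max => /orP[/IHt->|/IHu->]; rewrite ?orbT.
Qed.

Lemma fbound_fv x f : x \in fv f -> x < fbound f.
Proof.
elim: f => /= [u v|u v|f IHf g IHg|f IHf g IHg|z f IH|z f IH];
  rewrite leq_max ?mem_cat ?mem_filter.
- by case/orP=> /tbound_fv->; rewrite ?orbT.
- by case/orP=> /tbound_fv->; rewrite ?orbT.
- by case/orP=> [/IHf->|/IHg->]; rewrite ?orbT.
- by case/orP=> [/IHf->|/IHg->]; rewrite ?orbT.
- by case/andP=> _ /IH->; rewrite orbT.
- by case/andP=> _ /IH->; rewrite orbT.
Qed.

Lemma fbound_free_for y z f : fbound f <= z -> free_for y (Var z) f.
Proof.
elim: f => //= [f IHf g IHg|f IHf g IHg|x f IH|x f IH]; rewrite geq_max => /andP[].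
- by move=> /IHf-> /IHg->.
- by move=> /IHf-> /IHg->.
- by rewrite inE => xz /IH->; rewrite neq_ltn xz orbT.
- by rewrite inE => xz /IH->; rewrite neq_ltn xz orbT.
Qed.

Lemma sbound_mem f G : f \in G -> fbound f <= sbound G.
Proof. by move=> fG; rewrite /sbound (big_rem f) //= leq_maxl. Qed.

Lemma sbound_fv z G : sbound G <= z -> ~ in_fv z G.
Proof.
move=> Gz [f /sbound_mem fG /fbound_fv zf].
by move: (leq_trans (leq_trans zf fG) Gz); rewrite ltnn.
Qed.

Lemma uclosure_closed f : fv (uclosure f) = [::].
Proof.
rewrite /uclosure; set s := undup _.
have: {subset fv f <= s} by move=> x; rewrite mem_undup.
have -> : fv (foldr All f s) = [seq x <- fv f | x \notin s].
  elim: s => [|y s IH] /=; first by apply/esym/all_filterP/allP.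
  rewrite IH -filter_predI; apply: eq_filter => x /=.
  by rewrite inE negb_or.
move=> sub; apply/eqP; rewrite -size_eq0 size_filter -leqn0 leqNgt -has_count.
by apply/hasPn => x /sub ->.
Qed.

Lemma ssubst_mem f y t G : f \in ssubst y t G -> exists2 g, g \in G & f = subst y t g.
Proof.
by rewrite /ssubst (perm_mem (perm_eq_seq_mset _)) => /mapP[g gG ->]; exists g.
Qed.

Lemma mem_ssubst f y t G : f \in G -> subst y t f \in ssubst y t G.
Proof. by move=> fG; rewrite /ssubst (perm_mem (perm_eq_seq_mset _)); apply: map_f. Qed.

Lemma ssubst1D y t f G : ssubst y t (f +` G) = subst y t f +` ssubst y t G.
Proof.
rewrite /ssubst -mset_cons; apply/eq_seq_msetP.
rewrite -[_ :: _]/(map (subst y t) (f :: G)); apply: perm_map.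
rewrite -[f +` G]seq_mset_id; apply: perm_trans (perm_eq_seq_mset _) _.
by apply/eq_seq_msetP; rewrite mset_cons !seq_mset_id.
Qed.

Lemma ssubst0 y t : ssubst y t mset0 = mset0.
Proof. by rewrite /ssubst enum_mset0; apply/msetP => f; rewrite mset_seqE mset0E. Qed.

(** * Closure properties of regular proofs *)

Definition branch_shift (b : nat -> nat) (n : nat) := b n.+1.

Lemma mkseq_shift (b : nat -> nat) n : mkseq b n.+1 = b 0 :: mkseq (branch_shift b) n.
Proof. by rewrite /mkseq /= -[1]addn0 iotaDl -map_comp. Qed.

Lemma good_tail_shift (P P' : tree) b N :
  (forall a, P (b 0 :: a) = P' a) ->
  good_tail P' (branch_shift b) N -> good_tail P b N.+1.
Proof.
move=> PP'; have E n : rule_at P (mkseq b n.+1) = rule_at P' (mkseq (branch_shift b) n).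
  by rewrite mkseq_shift /rule_at PP'.
case=> left all [y right]; split.
- by case=> // n z Nn [/[!E] r0 b0]; apply: (left n z Nn).
- case=> // m [|n] z Nm mn // [/[!E] r1 b1]; exact: (all m n z).
- exists y => M; have [n Mn [r1 b1]] := right M.
  by exists n.+1; [lia|split; rewrite ?E].
Qed.

(** [T] lists finitely many candidate markings. Each one that occurs in [P] gets one occurrence as
    representative; the others get the root as a default. *)
Lemma regular_finite (P : tree) (I : finType) (T : I -> seq nat -> option sequent) :
  (forall a, P a <> None -> exists i, forall c, sequent_at P (a ++ c) = T i c) ->
  regular P.
Proof.
move=> PT.
have /choice[r rP] (i : I) : exists b, forall a,
    (forall c, sequent_at P (a ++ c) = T i c) -> subtree_iso P a b.
  have [[b bT]|nT] := pselect (exists b, forall c, sequent_at P (b ++ c) = T i c).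
    by exists b => a aT c; rewrite aT bT.
  by exists [::] => a aT; case: nT; exists a.
exists [seq r i | i <- enum I] => a /PT[i /rP iso].
by exists (r i) => //; apply: map_f; rewrite mem_enum.
Qed.

(** * Unfolding of finite graphs with grafted proofs *)

Section Unfold.
Variables (V : finType) (lab : V -> sequent * rule) (kids : V -> seq (V + tree)).

(** A child is either a vertex, possibly an earlier one, or a finished proof grafted there.
    Recursion on the address lets cycles become infinite branches. *)
Fixpoint unfold (x : V + tree) (a : seq nat) {struct a} : option (sequent * rule) :=
  match x with
  | inr P => P a
  | inl v =>
      match a with
      | [::] => Some (lab v)
      | i :: a' => if onth (kids v) i is Some x' then unfold x' a' else None
      end
  end.

Definition root_sequent (x : V + tree) : option sequent :=
  match x with inl v => Some (lab v).1 | inr P => sequent_at P [::] end.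

Hypothesis kids_sound :
  forall v, exists2 ps, SQ (lab v).2 ps (lab v).1
    & map root_sequent (kids v) = map Some ps.
Hypothesis kids_proof : forall v i P,
  onth (kids v) i = Some (inr P) -> (exists G, infty_proof P G) /\ regular P.
Hypothesis internal_branch : forall (s : nat -> V) b,
  (forall n, onth (kids (s n)) (b n) = Some (inl (s n.+1))) ->
  (forall n, unfold (inl (s 0)) (mkseq b n) = Some (lab (s n))) ->
  exists N, good_tail (unfold (inl (s 0))) b N.

Lemma unfold_inr P : unfold (inr P) =1 P.
Proof. by case. Qed.

Lemma sequent_at_unfold x : sequent_at (unfold x) [::] = root_sequent x.
Proof. by case: x. Qed.

Lemma unfold_correct v : locally_correct (unfold (inl v)).
Proof.
move=> a; elim: a v => [|i a IH] v /=.
  have [ps Hps kps] := kids_sound v; case Elab: (lab v) Hps => [G r] /= Hps.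
  exists ps => // i; rewrite /sequent_at /=.
  have := congr1 (fun s => onth s i) kps; rewrite /= !onth_map.
  case: (onth (kids v) i) => [x|] /=; case: (onth ps i) => [p|] //= [].
  by rewrite -sequent_at_unfold /sequent_at => ->.
rewrite /sequent_at /=; case Ei: (onth (kids v) i) => [[w|P]|] //; first exact: IH.
have [[G [_ /(_ a) + _]] _] := kids_proof Ei.
by rewrite unfold_inr /sequent_at; case: (P a) => [[? ?]|] Pa;
  [case: Pa => ps ? E; exists ps => // j|move=> j]; rewrite unfold_inr.
Qed.

(** The state is frozen once the branch enters a graft, so a branch stays in the graph exactly when
    no state is an [inr]. *)
Fixpoint state (x : V + tree) (b : nat -> nat) (n : nat) : V + tree :=
  match n, x with
  | n.+1, inl v =>
      if onth (kids v) (b 0) is Some x' then state x' (branch_shift b) n else x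
  | _, _ => x
  end.

(** The steps before the graft are peeled off one by one; from there on the condition is that of the
    grafted proof. *)
Lemma unfold_branch_tree n v b P :
  infinite_branch (unfold (inl v)) b -> state (inl v) b n = inr P ->
  exists N, good_tail (unfold (inl v)) b N.
Proof.
elim: n v b => //= n IH v b inf; case Ek: (onth _ _) => [x|] // st.
have E a : unfold (inl v) (b 0 :: a) = unfold x a by rewrite /= Ek.
have inf' : infinite_branch (unfold x) (branch_shift b).
  by move=> m; have := inf m.+1; rewrite mkseq_shift E.
suff [N tail] : exists N, good_tail (unfold x) (branch_shift b) N.
  by exists N.+1; apply: good_tail_shift tail.
case: x => [w|Q] in Ek st E inf' *; first exact: IH st.
have [[G [_ _ br]] _] := kids_proof Ek.
have -> : unfold (inr Q) = Q by apply: funext; exact: unfold_inr.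
by apply: br => m; rewrite -unfold_inr; apply: inf'.
Qed.

Lemma unfold_branch_internal v b :
  infinite_branch (unfold (inl v)) b -> (forall n P, state (inl v) b n <> inr P) ->
  exists N, good_tail (unfold (inl v)) b N.
Proof.
move=> inf int.
have /choice[s sE] n : exists w, state (inl v) b n = inl w.
  by case E: (state _ _ n) => [w|P]; [exists w|case: (int n P)].
have s0 : s 0 = v by have := sE 0; case=> <-.
have step n : onth (kids (s n)) (b n) = Some (inl (s n.+1)) /\
              unfold (inl v) (mkseq b n) = Some (lab (s n)).
  elim: n v b s inf {int} sE s0 => [|n IH] v b s inf sE s0.
    split; last by rewrite /= s0.
    have := sE 1; have := inf 1; rewrite /= s0 /mkseq /=.
    by case: (onth _ _) => // x _ ->.
  have Ek : onth (kids v) (b 0) = Some (inl (s 1)).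
    by have := sE 1; have := inf 1; rewrite /= /mkseq /=; case: (onth _ _) => // x _ ->.
  have [||//|ok oE] := IH (s 1) (branch_shift b) (fun n => s n.+1).
  - by move=> m; have := inf m.+1; rewrite mkseq_shift /= Ek.
  - by move=> m; have := sE m.+1; rewrite /= Ek.
  by split; [exact: ok | rewrite mkseq_shift /= Ek oE].
rewrite -s0; apply: internal_branch => n; have [] // := step n.
by rewrite s0.
Qed.

Lemma unfold_subtree v a :
  unfold (inl v) a <> None ->
  (exists w, forall c, unfold (inl v) (a ++ c) = unfold (inl w) c) \/
  (exists w i P a', [/\ onth (kids w) i = Some (inr P), P a' <> None
     & forall c, unfold (inl v) (a ++ c) = P (a' ++ c)]).
Proof.
elim: a v => [|i a IH] v /=; first by left; exists v.
case E: (onth _ _) => [[w|P]|] //; first exact: IH.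
rewrite unfold_inr => Pa; right; exists v, i, P, a; split=> // c.
by rewrite unfold_inr.
Qed.

(** A subtree starts at a vertex or inside a graft, and each graft is regular. The finite type [I]
    therefore collects the vertices and, for each edge into a graft, the representatives of that
    graft. *)
Lemma unfold_regular v : regular (unfold (inl v)).
Proof.
have /choice[L LP] (p : {w : V & 'I_(size (kids w))}) : exists L : seq (seq nat),
    forall P, onth (kids (tag p)) (tagged p) = Some (inr P) ->
    forall a, P a <> None -> exists2 b, b \in L & subtree_iso P a b.
  case E: (onth _ _) => [[w|P]|]; try by exists [::].
  by have [_ [L LP]] := kids_proof E; exists L => _ [<-].
pose I : finType := (V + {p : {w : V & 'I_(size (kids w))} & 'I_(size (L p))})%type.
pose T (i : I) : seq nat -> option sequent :=
  match i with
  | inl w => sequent_at (unfold (inl w))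
  | inr (existT p j) => fun c =>
      if onth (kids (tag p)) (tagged p) is Some (inr P)
      then sequent_at P (nth [::] (L p) j ++ c) else None
  end.
apply: (@regular_finite _ I T) => a /unfold_subtree[[w wE]|[w [i [P [a' [Ei Pa aE]]]]]].
  by exists (inl w) => c /=; rewrite /sequent_at wE.
have iw : i < size (kids w) by rewrite -onthTE Ei.
pose p : {w : V & 'I_(size (kids w))} := Tagged (fun w => 'I_(size (kids w))) (Ordinal iw).
have [b bL iso] := LP p P Ei a' Pa.
have jL : index b (L p) < size (L p) by rewrite index_mem.
exists (inr (Tagged (fun p => 'I_(size (L p))) (Ordinal jL))) => c.
by rewrite /= Ei nth_index // -iso /sequent_at aE.
Qed.

Lemma unfold_proof v :
  infty_proof (unfold (inl v)) (lab v).1 /\ regular (unfold (inl v)).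
Proof.
split; last exact: unfold_regular.
split=> //; first exact: unfold_correct.
move=> b inf.
have [[n [P nP]]|int] := pselect (exists n P, state (inl v) b n = inr P).
  exact: unfold_branch_tree nP.
by apply: unfold_branch_internal => // n P nP; apply: int; exists n, P.
Qed.

End Unfold.

(** * Simulation of derivations in PA *)

Definition regularly_provable (G : sequent) : Prop :=
  exists P, infty_proof P G /\ regular P.

(** A graph with a single vertex whose children are all grafts has no internal branch to check. *)
Lemma RP_rule r ps G :
  SQ r ps G -> {in ps, forall p, regularly_provable p} -> regularly_provable G.
Proof.
move=> rG psP.
have /choice[F FP] (p : sequent) : exists P, p \in ps -> infty_proof P p /\ regular P.
  have [/psP[P PP]|_] := boolP (p \in ps); first by exists P.
  by exists (fun=> None).
pose kids (_ : unit) : seq (unit + tree) := [seq inr (F p) | p <- ps].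
exists (unfold (fun _ => (G, r)) kids (inl tt)).
have kidsE i P : onth (kids tt) i = Some (inr P) -> exists2 p, p \in ps & P = F p.
  rewrite /kids onth_map; case E: (onth ps i) => [p|] //= [<-].
  by exists p => //; apply/onthP; exists i.
apply: (unfold_proof (lab := fun _ => (G, r))).
- case; exists ps => //; rewrite /kids -map_comp; apply/eq_in_map => p /FP[[]] //.
- by case=> i P /kidsE[p /FP[pP pR] ->]; split=> //; exists p.
- move=> s b /(_ 0); rewrite /kids onth_map; by case: (onth ps _).
Qed.

Ltac mset_ac := apply/msetP => ?; rewrite !msetE2; lia.

(** Applied to both calculi: with weakening and contraction, only the underlying set of a sequent
    matters. [G] is enlarged by a copy of [D], whose formulas are then contracted away one at a
    time. *)
Lemma set_monotone (R : sequent -> Prop) :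
  (forall G D, R G -> R (G `+` D)) ->
  (forall G f, R (f +` (f +` G)) -> R (f +` G)) ->
  forall D G : sequent, {subset D <= G} -> R D -> R G.
Proof.
move=> weak contr D G sDG RD.
have: R (G `+` seq_mset (enum_mset D)) by rewrite seq_mset_id msetDC; apply: weak.
have: {subset enum_mset D <= G} by [].
elim: (enum_mset D) => [|f l IH] sl.
  rewrite (_ : _ `+` _ = G) //; apply/msetP => g.
  by rewrite msetE2 mset_seqE addn0.
rewrite mset_cons => RG; apply: IH => [g gl|]; first by apply: sl; rewrite inE gl orbT.
have fG : f \in G by apply: sl; rewrite inE eqxx.
rewrite -(msetB1K fG) in RG *; set G' := _ `\ _ in RG *.
rewrite (_ : _ `+` _ = f +` (G' `+` seq_mset l)); last by mset_ac.
by apply: contr; rewrite (_ : _ +` _ = (f +` G') `+` (f +` seq_mset l)) //; mset_ac.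
Qed.

Lemma RP_weak G D : regularly_provable G -> regularly_provable (G `+` D).
Proof. by move=> GP; apply: (RP_rule (SQ_weak G D)) => p; rewrite inE => /eqP->. Qed.

Lemma RP_rule1 r p G : SQ r [:: p] G -> regularly_provable p -> regularly_provable G.
Proof. by move=> rG pP; apply: (RP_rule rG) => q; rewrite inE => /eqP->. Qed.

Lemma RP_rule2 r p q G : SQ r [:: p; q] G ->
  regularly_provable p -> regularly_provable q -> regularly_provable G.
Proof. by move=> rG pP qP; apply: (RP_rule rG) => x; rewrite !inE => /orP[]/eqP->. Qed.

(** Initial sequents supply the atomic case. Quantifiers are handled with a fresh active variable
    that also serves as the existential witness, hence the induction on size. *)
Lemma RP_id f G : regularly_provable (f +` (neg f +` G)).
Proof.
have [n] := ubnP (fsize f); elim: n f G => // n IH f G.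
case: f => [t u|t u|f g|f g|y f|y f] /= szf.
- exact: RP_rule (SQ_init_eq G t u) _.
- by rewrite msetDCA; apply: RP_rule (SQ_init_eq G t u) _.
- apply: (RP_rule2 (SQ_and _ f g)); rewrite msetDCA; apply: RP_rule1 (SQ_or _ _ _) _.
  + rewrite (_ : _ +` _ = f +` (neg f +` (neg g +` G))); [apply: IH; lia|mset_ac].
  + rewrite (_ : _ +` _ = g +` (neg g +` (neg f +` G))); [apply: IH; lia|mset_ac].
- rewrite msetDCA; apply: (RP_rule2 (SQ_and _ (neg f) (neg g)));
    rewrite msetDCA; apply: RP_rule1 (SQ_or _ _ _) _.
  + rewrite (_ : _ +` _ = f +` (neg f +` (g +` G))); [apply: IH; lia|mset_ac].
  + rewrite (_ : _ +` _ = g +` (neg g +` (f +` G))); [apply: IH; lia|mset_ac].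
- set D := Ex y (neg f) +` G; pose z := sbound (All y f +` D).
  have fz : free_for y (Var z) f.
    apply: fbound_free_for; apply: leq_trans (sbound_mem (f := All y f) _).
      exact: leq_maxr.
    by rewrite in_mset1D eqxx.
  apply: (RP_rule1 (SQ_all (z := z) _ fz)); first exact: sbound_fv.
  rewrite /D msetDCA; apply: (RP_rule1 (SQ_ex (t := Var z) _ _)); first by rewrite free_for_neg.
  rewrite -neg_subst (_ : _ +` _ = subst y (Var z) f +` (neg (subst y (Var z) f) +` D)).
    by apply: IH; rewrite fsize_subst; lia.
  by rewrite /D; mset_ac.
- rewrite msetDCA; set D := Ex y f +` G; pose z := sbound (All y (neg f) +` D).
  have fz : free_for y (Var z) f.
    apply: fbound_free_for; apply: leq_trans (sbound_mem (f := Ex y f) _).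
      exact: leq_maxr.
    by rewrite !in_mset1D eqxx orbT.
  apply: (RP_rule1 (SQ_all (z := z) _ _)); first exact: sbound_fv.
    by rewrite free_for_neg.
  rewrite /D msetDCA; apply: (RP_rule1 (SQ_ex (t := Var z) _ fz)).
  rewrite -neg_subst (_ : _ +` _ = subst y (Var z) f +` (neg (subst y (Var z) f) +` D)).
    by apply: IH; rewrite fsize_subst; lia.
  by rewrite /D; mset_ac.
Qed.

Lemma RP_sub (D G : sequent) :
  {subset D <= G} -> regularly_provable D -> regularly_provable G.
Proof.
apply: set_monotone; first exact: RP_weak.
move=> {}G f fG; apply: (RP_rule2 (SQ_cut (f +` G) f)) => //.
by rewrite msetDCA; apply: RP_id.
Qed.

Lemma RP_id_mem f (G : sequent) : f \in G -> neg f \in G -> regularly_provable G.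
Proof.
move=> fG nG; apply: RP_sub (RP_id f mset0) => g.
by rewrite !in_mset1D in_mset0 orbF => /orP[]/eqP->.
Qed.

Lemma RP_FOL (T : formula -> Prop) G :
  (forall f, T f -> regularly_provable [mset f]) -> FOL T G -> regularly_provable G.
Proof.
move=> TP; elim=> {G}.
- by move=> G f /TP; apply: RP_weak.
- by move=> G f; apply: RP_id.
- move=> G t; apply: RP_rule1 (SQ_ref _ t) _; apply: (RP_id_mem (f := Eq t t));
    by rewrite !in_mset1D eqxx ?orbT.
- move=> G y t0 t1 u0 u1 /=.
  apply: RP_rule1 (SQ_rep _ y t0 t1 u0 u1) _.
  apply: (RP_id_mem (f := subst y t1 (Eq u0 u1))); by rewrite !in_mset1D eqxx ?orbT.
- by move=> G f g _ fP _ gP; apply: RP_rule2 (SQ_and _ _ _) fP gP.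
- by move=> G f g _; apply: RP_rule1 (SQ_or _ _ _).
- by move=> G y z f zG fz _; apply: RP_rule1 (SQ_all zG fz).
- move=> G y t f ft _ fP; apply: RP_rule1 (SQ_ex _ ft) _.
  by apply: RP_sub fP => g; rewrite !in_mset1D => /orP[->|->]; rewrite ?orbT.
- by move=> G D _; apply: RP_weak.
- by move=> G f _; apply: RP_sub => g; rewrite !in_mset1D orbA orbb.
- by move=> G f _ fP _ nP; apply: RP_rule2 (SQ_cut _ _) fP nP.
Qed.

(** Without side formulas, (forall) may take [y] itself as active variable. *)
Lemma RP_closure f : regularly_provable [mset f] -> regularly_provable [mset uclosure f].
Proof.
rewrite /uclosure; elim: (undup _) => //= y s IH /IH {IH}; set g := foldr _ _ _ => gP.
rewrite -[[mset _]]msetD0; apply: (RP_rule1 (SQ_all (z := y) _ _)).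
- by case=> h; rewrite in_mset1D in_mset0 orbF => /eqP->; rewrite mem_filter /= eqxx.
- by apply: free_for_self => x; rewrite inE.
- by rewrite subst_var msetD0.
Qed.

Section InductionLoop.
Variables (x : nat) (f : formula) (hx : x \in fv f).
Let f0 := subst x Zero f.
Let fS := subst x (Succ (Var x)) f.
Let E := Ex x (And f (neg fS)).
Let D := neg f0 +` [mset E].
Variables (P0 P1 : tree).
Hypothesis P0P : infty_proof P0 (f0 +` D) /\ regular P0.
Hypothesis P1P : infty_proof P1 (neg fS +` (fS +` D)) /\ regular P1.

(** A cycle of four vertices: the right premiss of (case) leads from [f, D] to [fS, D]; (exists)
    opens [E]; the left premiss of (and) is [f, fS, D], which weakens back to [f, D]. The exits [P0]
    and [P1] prove sequents that contain a formula and its negation. *)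
Let lab (v : bool * bool) : sequent * rule :=
  match v with
  | (false, false) => (f +` D, Case x)
  | (false, true) => (fS +` D, REx)
  | (true, false) => (And f (neg fS) +` (fS +` D), RAnd)
  | (true, true) => (f +` (fS +` D), Weak)
  end.

Let kids (v : bool * bool) : seq ((bool * bool) + tree) :=
  match v with
  | (false, false) => [:: inr P0; inl (false, true)]
  | (false, true) => [:: inl (true, false)]
  | (true, false) => [:: inl (true, true); inr P1]
  | (true, true) => [:: inl (false, false)]
  end.

Lemma RP_induction_loop : regularly_provable (f +` D).
Proof.
exists (unfold lab kids (inl (false, false))).
apply: (@unfold_proof _ lab kids _ _ _ (false, false)).
(* [x] is bound in [E] and replaced by 0 in [f0], so (case) acts on [f] alone. *)
- have Dsub t : ssubst x t D = D.
    rewrite /D -[[mset E]]msetD0 !ssubst1D ssubst0 !subst_id //=.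
      by rewrite mem_filter /= eqxx.
    by rewrite fv_neg fv_subst_closed.
  have [[P0r _ _] _] := P0P; have [[P1r _ _] _] := P1P.
  case=> [[] []] /=.
  + exists [:: f +` D] => //.
    by rewrite (_ : f +` (fS +` D) = (f +` D) `+` [mset fS]); [exact: SQ_weak|mset_ac].
  + exists [:: f +` (fS +` D); neg fS +` (fS +` D)]; first exact: SQ_and.
    by rewrite /= P1r.
  + exists [:: And f (neg fS) +` (fS +` D)] => //.
    have := @SQ_ex (fS +` [mset neg f0]) x (Var x) (And f (neg fS)).
    rewrite subst_var free_for_self => [/(_ isT)|z]; last by rewrite inE.
    rewrite (_ : Ex _ _ +` _ = fS +` D); last by rewrite /D -/E; mset_ac.
    exact.
  + exists [:: f0 +` D; fS +` D]; last by rewrite /= P0r.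
    have := @SQ_case (f +` D) x; rewrite !(ssubst1D x _ f D) !Dsub; apply.
    by exists f => //; rewrite in_mset1D eqxx.
- have ext G P : infty_proof P G /\ regular P -> (exists G, infty_proof P G) /\ regular P.
    by case=> pP rP; split=> //; exists G.
  by case=> [[] []] [|[|i]] P; rewrite /= ?onth0n // => -[<-]; apply: ext; eassumption.
- move=> s b sb un.
  have labE n : rule_at (unfold lab kids (inl (s 0))) (mkseq b n) = Some (lab (s n)).2.
    by rewrite /rule_at un.
  exists 0; split.
  + move=> n y _ [] /[!labE]; have := sb n.
    by case: (s n) => [[] []] //= + _ bn; rewrite bn.
  + by move=> m n z _ _ _ /[!labE]; case: (s n) => [[] []].
  exists x => M.
  have step n : s n.+1 = match s n with
      | (false, false) => (false, true) | (false, true) => (true, false)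
      | (true, false) => (true, true) | (true, true) => (false, false) end.
    by have := sb n; case: (s n) => [[] []]; case: (b n) => [|[|i]] //=;
      rewrite ?onth0n // => -[].
  (* An internal branch runs round the cycle, so four consecutive steps always include the (case)
     vertex. *)
  have [n Mn sn] : exists2 n, M <= n & s n = (false, false).
    have := (step M, step M.+1, step M.+2); case sM: (s M) => [[] []] sE.
    * by exists M.+1; [lia|rewrite sE].
    * by exists M.+2; [lia|rewrite !sE].
    * by exists M.+3; [lia|rewrite !sE].
    * by exists M; [lia|].
  exists n; rewrite ?maxn0 //; split; rewrite ?labE ?sn //.
  by have := sb n; rewrite sn; case: (b n) => [|[|i]] //=; rewrite onth0n.
Qed.

End InductionLoop.

Lemma RP_induction x f : regularly_provable [mset induction_axiom x f].
Proof.
rewrite /induction_axiom /imp; rewrite -[[mset _]]msetD0; set f0 := subst x Zero f.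
set fS := subst x _ f; set E := Ex x (And f (neg fS)).
have loop : regularly_provable (f +` (neg f0 +` [mset E])).
  (* The rule (case) requires [x] to be free; otherwise [f0] is [f] and the sequent is an
     identity. *)
  have [xf|xf] := boolP (x \in fv f); last first.
    apply: (RP_id_mem (f := f)); rewrite !in_mset1D ?eqxx //.
    by rewrite /f0 subst_id // eqxx orbT.
  have [P0 P0P] := RP_id f0 [mset E].
  have [||P1 P1P] := @RP_id_mem fS (neg fS +` (fS +` (neg f0 +` [mset E]))).
  - by rewrite !in_mset1D eqxx !orbT.
  - by rewrite !in_mset1D eqxx.
  exact: (@RP_induction_loop x f xf P0 P1 P0P P1P).
apply: RP_rule1 (SQ_or _ _ _) _ => /=; apply: RP_rule1 (SQ_or _ _ _) _ => /=.
rewrite negK -/E (_ : _ +` _ = All x f +` (neg f0 +` [mset E]));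
  last by rewrite msetD0; mset_ac.
apply: (RP_rule1 (SQ_all (z := x) _ _)).
- case=> h; rewrite !in_mset1D in_mset1 => /or3P[]/eqP->;
    rewrite /= ?mem_filter /= ?eqxx //.
  by rewrite fv_neg; apply/negP; rewrite fv_subst_closed.
- by apply: free_for_self => z; rewrite inE.
- by rewrite subst_var.
Qed.

Lemma RP_robinson f : f \in Q_matrices -> regularly_provable [mset f].
Proof.
rewrite !inE => /or4P[| | |/or4P[]] /eqP->; rewrite -[[mset _]]msetD0.
- exact: RP_rule (SQ_init_succ _ _) _.
- apply: RP_rule1 (SQ_or _ _ _) _; apply: RP_rule1 (SQ_pred _ _ _) _.
  by apply: (RP_id_mem (f := Eq (Var 0) (Var 1))); rewrite !in_mset1D eqxx ?orbT.
- apply: RP_rule1 (SQ_or _ _ _) _.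
  (* In the successor case the witness is variable 0 again, now standing for the predecessor. *)
  apply: (RP_rule2 (SQ_case (y := 0) _)).
  + by exists (Eq (Var 0) Zero); rewrite ?in_mset1D ?eqxx.
  + rewrite !ssubst1D ssubst0 /=; apply: RP_rule1 (SQ_ref _ Zero) _.
    by apply: (RP_id_mem (f := Eq Zero Zero)); rewrite !in_mset1D eqxx ?orbT.
  + rewrite !ssubst1D ssubst0 /= msetDCA.
    apply: (RP_rule1 (SQ_ex (t := Var 0) _ _)) => //=.
    apply: RP_rule1 (SQ_ref _ (Succ (Var 0))) _.
    by apply: (RP_id_mem (f := Eq (Succ (Var 0)) (Succ (Var 0))));
      rewrite !in_mset1D eqxx ?orbT.
- apply: RP_rule1 (SQ_add0 _ (Var 0)) _.
  by rewrite msetDCA; apply: RP_rule (SQ_init_eq _ _ _) _.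
- apply: RP_rule1 (SQ_addS _ (Var 0) (Var 1)) _.
  by rewrite msetDCA; apply: RP_rule (SQ_init_eq _ _ _) _.
- apply: RP_rule1 (SQ_mult0 _ (Var 0)) _.
  by rewrite msetDCA; apply: RP_rule (SQ_init_eq _ _ _) _.
- apply: RP_rule1 (SQ_multS _ (Var 0) (Var 1)) _.
  by rewrite msetDCA; apply: RP_rule (SQ_init_eq _ _ _) _.
Qed.

Lemma RP_PA f : provable PA f -> regularly_provable [mset f].
Proof.
apply: RP_FOL => _ [g /RP_robinson|x g]; first exact: RP_closure.
exact/RP_closure/RP_induction.
Qed.

(** * Semantics *)

(* Equality is interpreted by a congruence rather than by identity, so that the
   term model below needs no quotient. *)
Record structure := Structure {
  dom :> Type;
  eqv : dom -> dom -> Prop;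
  zero : dom;
  succ : dom -> dom;
  plus : dom -> dom -> dom;
  mult : dom -> dom -> dom;
  eqv_refl : forall a, eqv a a;
  eqv_sym : forall a b, eqv a b -> eqv b a;
  eqv_trans : forall a b c, eqv a b -> eqv b c -> eqv a c;
  eqv_succ : forall a b, eqv a b -> eqv (succ a) (succ b);
  eqv_plus : forall a b c d, eqv a b -> eqv c d -> eqv (plus a c) (plus b d);
  eqv_mult : forall a b c d, eqv a b -> eqv c d -> eqv (mult a c) (mult b d) }.

Arguments zero {s}.
Arguments eqv {s}.

Definition upd (D : Type) (rho : nat -> D) (y : nat) (d : D) (x : nat) : D :=
  if x == y then d else rho x.

Section Semantics.
Variable M : structure.
Implicit Types (rho : nat -> M) (d : M).

Fixpoint eval rho (t : term) : M :=
  match t with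
  | Var x => rho x
  | Zero => zero
  | Succ t => succ (eval rho t)
  | Plus t u => plus (eval rho t) (eval rho u)
  | Mult t u => mult (eval rho t) (eval rho u)
  end.

Fixpoint sat rho (f : formula) : Prop :=
  match f with
  | Eq t u => eqv (eval rho t) (eval rho u)
  | Neq t u => ~ eqv (eval rho t) (eval rho u)
  | And f g => sat rho f /\ sat rho g
  | Or f g => sat rho f \/ sat rho g
  | All x f => forall d, sat (upd rho x d) f
  | Ex x f => exists d, sat (upd rho x d) f
  end.

Definition falsifies rho (G : sequent) : Prop := forall f, f \in G -> ~ sat rho f.

Lemma eval_eqv rho rho' t :
  {in tfv t, forall x, eqv (rho x) (rho' x)} -> eqv (eval rho t) (eval rho' t).
Proof.
elim: t => /= [x|_|t IH H|t IHt u IHu H|t IHt u IHu H].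
- by apply; rewrite inE.
- exact: eqv_refl.
- exact/eqv_succ/IH.
- by apply: eqv_plus; [apply: IHt|apply: IHu] => x xt; apply: H; rewrite mem_cat xt ?orbT.
- by apply: eqv_mult; [apply: IHt|apply: IHu] => x xt; apply: H; rewrite mem_cat xt ?orbT.
Qed.

Lemma sat_eqv_sub rho rho' f :
  {in fv f, forall x, eqv (rho x) (rho' x)} -> sat rho f -> sat rho' f.
Proof.
have upd_eqv (r r' : nat -> M) x d g :
    {in [seq z <- fv g | predC1 x z], forall z, eqv (r z) (r' z)} ->
    {in fv g, forall z, eqv (upd r x d z) (upd r' x d z)}.
  move=> H z zg; rewrite /upd; case: (eqVneq z x) => [_|zx]; first exact: eqv_refl.
  by apply: H; rewrite mem_filter /= zx.
have eval2 (r r' : nat -> M) t u : {in tfv t ++ tfv u, forall z, eqv (r z) (r' z)} ->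
    eqv (eval r t) (eval r' t) /\ eqv (eval r u) (eval r' u).
  by move=> H; split; apply: eval_eqv => z zt; apply: H; rewrite mem_cat zt ?orbT.
elim: f rho rho' => /= [t u|t u|f IHf g IHg|f IHf g IHg|x f IH|x f IH] rho rho' H.
- have [Ht Hu] := eval2 _ _ _ _ H => tu.
  exact: eqv_trans (eqv_sym Ht) (eqv_trans tu Hu).
- have [Ht Hu] := eval2 _ _ _ _ H => ntu tu; apply: ntu.
  exact: eqv_trans Ht (eqv_trans tu (eqv_sym Hu)).
- case=> sf sg; split; [apply: IHf sf|apply: IHg sg] => z zf;
    by apply: H; rewrite mem_cat zf ?orbT.
- case=> [sf|sg]; [left; apply: IHf sf|right; apply: IHg sg] => z zf;
    by apply: H; rewrite mem_cat zf ?orbT.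
- by move=> sf d; apply: IH (sf d); apply: upd_eqv.
- by case=> d sf; exists d; apply: IH sf; apply: upd_eqv.
Qed.

Lemma sat_eqv rho rho' f :
  {in fv f, forall x, eqv (rho x) (rho' x)} -> sat rho f <-> sat rho' f.
Proof.
by move=> H; split; apply: sat_eqv_sub => // x /H; apply: eqv_sym.
Qed.

Lemma sat_ext rho rho' f : {in fv f, rho =1 rho'} -> sat rho f <-> sat rho' f.
Proof. by move=> H; apply: sat_eqv => x /H->; apply: eqv_refl. Qed.

Lemma eval_ext rho rho' t : {in tfv t, rho =1 rho'} -> eval rho t = eval rho' t.
Proof.
elim: t => //= [x|t IH H|t IHt u IHu H|t IHt u IHu H].
- by apply; rewrite inE.
- by rewrite IH.
- by rewrite IHt ?IHu // => x xt; apply: H; rewrite mem_cat xt ?orbT.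
- by rewrite IHt ?IHu // => x xt; apply: H; rewrite mem_cat xt ?orbT.
Qed.

Lemma eval_tsubst rho y t u :
  eval rho (tsubst y t u) = eval (upd rho y (eval rho t)) u.
Proof. by elim: u => //= [x|u ->|u -> v ->|u -> v ->] //; rewrite /upd; case: eqP. Qed.

Lemma sat_subst rho y t f : free_for y t f ->
  sat rho (subst y t f) <-> sat (upd rho y (eval rho t)) f.
Proof.
(* [free_for] imposes nothing below a binder where [y] is not free; there the value of [y] is
   irrelevant. *)
have vac g r : y \notin fv g -> sat r (subst y t g) <-> sat (upd r y (eval r t)) g.
  move=> yg; rewrite subst_id //; apply: sat_ext => z zg.
  by rewrite /upd; case: eqP => // zy; rewrite -zy zg in yg.
have binder g x r d :
    (forall r, sat r (subst y t g) <-> sat (upd r y (eval r t)) g) ->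
    x != y -> x \notin tfv t ->
    sat (upd r x d) (subst y t g) <-> sat (upd (upd r y (eval r t)) x d) g.
  move=> IH xy xt; rewrite IH; apply: sat_ext => z _.
  rewrite (@eval_ext (upd r x d) r) => [|w wt]; last first.
    by rewrite /upd; case: eqP => // wx; rewrite -wx wt in xt.
  by rewrite /upd; case: (eqVneq z y) => // ->; rewrite eq_sym (negPf xy).
elim: f rho => [u v|u v|f IHf g IHg|f IHf g IHg|x f IH|x f IH] rho.
- by rewrite /= !eval_tsubst.
- by rewrite /= !eval_tsubst.
- by case/andP=> /IHf + /IHg => /= -> ->.
- by case/andP=> /IHf + /IHg => /= -> ->.
- case/orP=> [/vac//|/andP[xt yt]].
  have [xy|xy] := eqVneq x y; first by apply: vac; rewrite xy /= mem_filter /= eqxx.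
  rewrite /= (negPf xy); have B := binder f x rho _ (fun r => IH r yt) xy xt.
  by split=> H d; apply/B.
- case/orP=> [/vac//|/andP[xt yt]].
  have [xy|xy] := eqVneq x y; first by apply: vac; rewrite xy /= mem_filter /= eqxx.
  rewrite /= (negPf xy); have B := binder f x rho _ (fun r => IH r yt) xy xt.
  by split=> -[d H]; exists d; apply/B.
Qed.

Lemma sat_neg rho f : sat rho (neg f) <-> ~ sat rho f.
Proof.
elim: f rho => [u v|u v|f IHf g IHg|f IHf g IHg|x f IH|x f IH] rho //=.
- by rewrite notK.
- by rewrite IHf IHg not_andE.
- by rewrite IHf IHg not_orE.
- split=> [[d /IH nd] /(_ d)//|/existsNP[d nd]]; by exists d; apply/IH.
- by split=> [H [d fd]|H d]; [case/IH: (H d)|apply/IH => fd; apply: H; exists d].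
Qed.

Lemma sat_uclosure rho f : sat rho (uclosure f) -> sat rho f.
Proof.
rewrite /uclosure; elim: (undup _) => //= x s IH /(_ (rho x)) H; apply: IH.
by apply: sat_eqv_sub H => z _; rewrite /upd; case: eqP => [->|_]; apply: eqv_refl.
Qed.

Lemma sat_closed rho rho' f : fv f = [::] -> sat rho f -> sat rho' f.
Proof. by move=> f0; apply: sat_eqv_sub => x; rewrite f0. Qed.

End Semantics.

(** * Completeness *)

Lemma FOL_sub (T : formula -> Prop) (D G : sequent) : {subset D <= G} -> FOL T D -> FOL T G.
Proof. by apply: set_monotone; [exact: FOL_weak|exact: FOL_contr]. Qed.

Lemma FOL_id_mem (T : formula -> Prop) f (G : sequent) : f \in G -> neg f \in G -> FOL T G.
Proof.
move=> fG nG; apply: FOL_sub (FOL_id T mset0 f) => g.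
by rewrite !in_mset1D in_mset0 orbF => /orP[]/eqP->.
Qed.

Section Henkin.
Variables (T : formula -> Prop) (G0 : sequent).
Hypothesis T_closed : forall f, T f -> fv f = [::].
Hypothesis G0_underivable : ~ FOL T G0.
Variable enum_formula : nat -> option formula.
Hypothesis enum_formula_surj : forall f, exists n, enum_formula n = Some f.

(** The stages collect formulas to be made false: [f] if underivability permits, its negation
    otherwise. A universal formula brings along an instance at a fresh variable as its
    counterexample. *)
Definition henkin_step (G : sequent) (f : formula) : sequent :=
  if `[< FOL T (f +` G) >] then neg f +` G
  else if f is All y g then subst y (Var (sbound (f +` G))) g +` (f +` G)
  else f +` G.

Fixpoint henkin_chain (n : nat) : sequent :=
  if n is n.+1 then
    if enum_formula n is Some f then henkin_step (henkin_chain n) f else henkin_chain n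
  else G0.

Definition refuted (f : formula) : Prop := exists n, f \in henkin_chain n.

Lemma henkin_step_sub G f : {subset G <= henkin_step G f}.
Proof.
move=> g gG; rewrite /henkin_step; case: asboolP => _; last case: f => *;
  by rewrite !in_mset1D gG ?orbT.
Qed.

(** If the negation was added, a derivation would give one of [G] by cut. A witness is discharged by
    the rule for [All], and the second copy of the universal formula is contracted. *)
Lemma henkin_step_underivable G f : ~ FOL T G -> ~ FOL T (henkin_step G f).
Proof.
move=> nG; rewrite /henkin_step; case: asboolP => fG.
  by move=> nfG; apply: nG; apply: FOL_cut fG nfG.
case: f fG => // y g fG H; apply: fG; apply: FOL_contr.
apply: FOL_all H; last first.
  apply: fbound_free_for; apply: leq_trans (sbound_mem (f := All y g) _).
    exact: leq_maxr.
  by rewrite in_mset1D eqxx.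
by case=> h; rewrite in_mset1D => /orP[/eqP->|hG] hz;
  apply: (@sbound_fv _ (All y g +` G) (leqnn _)); [exists (All y g)|exists h];
  rewrite // in_mset1D eqxx.
Qed.

Lemma henkin_chain_underivable n : ~ FOL T (henkin_chain n).
Proof.
elim: n => //= n IH; case: (enum_formula n) => [f|//].
exact: henkin_step_underivable.
Qed.

Lemma henkin_chain_sub m n : m <= n -> {subset henkin_chain m <= henkin_chain n}.
Proof.
move=> /subnK<-; elim: (n - m) => // k IH f /IH fk /=.
by case: enum_formula => [g|//]; apply: henkin_step_sub.
Qed.

(** The stages increase, so finitely many refuted formulas lie in a single stage. *)
Lemma refuted_underivable (D : sequent) :
  (forall f, f \in D -> refuted f) -> ~ FOL T D.
Proof.
move=> DF; suff [n sub] : exists n, {subset enum_mset D <= henkin_chain n}.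
  by move=> /(FOL_sub sub); apply: henkin_chain_underivable.
elim: (enum_mset D) (DF : forall f, f \in enum_mset D -> refuted f) => [|f l IH] lF.
  by exists 0.
have [|n ln] := IH; first by move=> g gl; apply: lF; rewrite inE gl orbT.
have [|m fm] := lF f; first by rewrite inE eqxx.
exists (maxn m n) => g; rewrite inE => /orP[/eqP->|/ln].
  by apply: henkin_chain_sub fm; apply: leq_maxl.
by apply: henkin_chain_sub; apply: leq_maxr.
Qed.

Lemma refuted_neg f : refuted (neg f) <-> ~ refuted f.
Proof.
split=> [nf rf|nf].
  apply: (@refuted_underivable (f +` (neg f +` mset0))); last exact: FOL_id.
  by move=> g; rewrite !in_mset1D in_mset0 orbF => /orP[]/eqP->.
have [n nE] := enum_formula_surj f.
exists n.+1; rewrite /= nE /henkin_step; case: asboolP => [_|nD].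
  by rewrite in_mset1D eqxx.
case: nf; exists n.+1; rewrite /= nE /henkin_step asboolF //.
by case: f {nD nE} => *; rewrite !in_mset1D eqxx ?orbT.
Qed.

Lemma refuted_and f g : refuted (And f g) <-> refuted f \/ refuted g.
Proof.
split=> [rfg|rfg].
  apply: contrapT; rewrite not_orE -!refuted_neg => -[nf ng].
  apply: (@refuted_underivable (And f g +` (neg f +` [mset neg g]))).
    by move=> h; rewrite !in_mset1D in_mset1 => /or3P[]/eqP->.
  by apply: FOL_and; [apply: (@FOL_id_mem T f)|apply: (@FOL_id_mem T g)];
    rewrite !in_mset1D ?in_mset1 eqxx ?orbT.
apply: contrapT => /refuted_neg /= nfg; case: rfg => r.
  apply: (@refuted_underivable (Or (neg f) (neg g) +` [mset f])).
    by move=> h; rewrite !in_mset1D in_mset1 => /orP[]/eqP->.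
  by apply: FOL_or; apply: (@FOL_id_mem T f); rewrite !in_mset1D ?in_mset1 eqxx ?orbT.
apply: (@refuted_underivable (Or (neg f) (neg g) +` [mset g])).
  by move=> h; rewrite !in_mset1D in_mset1 => /orP[]/eqP->.
by apply: FOL_or; apply: (@FOL_id_mem T g); rewrite !in_mset1D ?in_mset1 eqxx ?orbT.
Qed.

(** The witness enters at the stage that treats [All y g]: that stage cannot choose the negation,
    since [All y g] and the earlier stage are refuted together. *)
Lemma refuted_all y g : refuted (All y g) ->
  exists z, fbound (All y g) <= z /\ refuted (subst y (Var z) g).
Proof.
move=> [n fn]; set f := All y g in fn *; have [m mE] := enum_formula_surj f.
exists (sbound (f +` henkin_chain m)); split.
  by apply: sbound_mem; rewrite in_mset1D eqxx.
exists m.+1; rewrite /= mE /henkin_step asboolF ?in_mset1D ?eqxx // => fD.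
apply: (@refuted_underivable (f +` henkin_chain m)) fD => h.
by rewrite in_mset1D => /orP[/eqP->|hm]; [exists n|exists m].
Qed.

Lemma refuted_ex y t g : free_for y t g -> refuted (Ex y g) -> refuted (subst y t g).
Proof.
move=> ft rg; apply: contrapT => /refuted_neg r.
apply: (@refuted_underivable (Ex y g +` [mset neg (subst y t g)])).
  by move=> h; rewrite !in_mset1D in_mset1 => /orP[]/eqP->.
by apply: (FOL_ex ft); apply: (@FOL_id_mem T (subst y t g));
  rewrite !in_mset1D ?in_mset1 eqxx ?orbT.
Qed.

Definition term_eqv (t u : term) : Prop := ~ refuted (Eq t u).

Lemma term_eqv_refl t : term_eqv t t.
Proof.
move=> r; apply: (@refuted_underivable (Eq t t +` mset0)); last exact: FOL_refl.
by move=> h; rewrite in_mset1D in_mset0 orbF => /eqP->.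
Qed.

Lemma refuted3 f g h : refuted f -> refuted g -> refuted h ->
  ~ FOL T (f +` (g +` (h +` mset0))).
Proof.
move=> rf rg rh; apply: refuted_underivable => k.
by rewrite !in_mset1D in_mset0 orbF => /or3P[]/eqP->.
Qed.

(** Symmetry, transitivity and the congruences all follow by marking the place of replacement with a
    fresh [y]. *)
Lemma term_eqv_repl y t0 t1 u0 u1 : term_eqv t0 t1 ->
  term_eqv (tsubst y t0 u0) (tsubst y t0 u1) ->
  term_eqv (tsubst y t1 u0) (tsubst y t1 u1).
Proof.
move=> /refuted_neg t01 /refuted_neg u01 r.
exact: (refuted3 t01 u01 r (FOL_repl T mset0 y t0 t1 u0 u1)).
Qed.

Lemma tsubst_bound t u y : tbound u <= y -> tsubst y t u = u.
Proof.
by move=> uy; rewrite tsubst_id //; apply/negP => /tbound_fv; rewrite ltnNge uy.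
Qed.

Lemma term_eqv_sym t u : term_eqv t u -> term_eqv u t.
Proof.
move=> tu; have := @term_eqv_repl (tbound t) t u (Var (tbound t)) t tu.
by rewrite /= eqxx !tsubst_bound //; apply; apply: term_eqv_refl.
Qed.

Lemma term_eqv_trans t u v : term_eqv t u -> term_eqv u v -> term_eqv t v.
Proof.
move=> tu uv; have := @term_eqv_repl (tbound t) u v t (Var (tbound t)) uv.
by rewrite /= eqxx !tsubst_bound //; apply.
Qed.

Lemma term_eqv_succ a b : term_eqv a b -> term_eqv (Succ a) (Succ b).
Proof.
move=> ab; have := @term_eqv_repl (tbound a) a b (Succ a) (Succ (Var (tbound a))) ab.
by rewrite /= eqxx !tsubst_bound //; apply; apply: term_eqv_refl.
Qed.

Lemma term_eqv_plus a b c d :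
  term_eqv a b -> term_eqv c d -> term_eqv (Plus a c) (Plus b d).
Proof.
move=> ab cd; pose y := maxn (tbound a) (maxn (tbound b) (tbound c)).
apply: (@term_eqv_trans _ (Plus b c)).
  have := @term_eqv_repl y a b (Plus a c) (Plus (Var y) c) ab.
  rewrite /= eqxx !(@tsubst_bound _ a y) ?(@tsubst_bound _ c y) //; try by rewrite /y; lia.
  by apply; apply: term_eqv_refl.
have := @term_eqv_repl y c d (Plus b c) (Plus b (Var y)) cd.
rewrite /= eqxx !(@tsubst_bound _ b y) ?(@tsubst_bound _ c y) //; try by rewrite /y; lia.
by apply; apply: term_eqv_refl.
Qed.

Lemma term_eqv_mult a b c d :
  term_eqv a b -> term_eqv c d -> term_eqv (Mult a c) (Mult b d).
Proof.
move=> ab cd; pose y := maxn (tbound a) (maxn (tbound b) (tbound c)).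
apply: (@term_eqv_trans _ (Mult b c)).
  have := @term_eqv_repl y a b (Mult a c) (Mult (Var y) c) ab.
  rewrite /= eqxx !(@tsubst_bound _ a y) ?(@tsubst_bound _ c y) //; try by rewrite /y; lia.
  by apply; apply: term_eqv_refl.
have := @term_eqv_repl y c d (Mult b c) (Mult b (Var y)) cd.
rewrite /= eqxx !(@tsubst_bound _ b y) ?(@tsubst_bound _ c y) //; try by rewrite /y; lia.
by apply; apply: term_eqv_refl.
Qed.

Definition term_model : structure :=
  @Structure term term_eqv Zero Succ Plus Mult term_eqv_refl term_eqv_sym
    term_eqv_trans term_eqv_succ term_eqv_plus term_eqv_mult.

Lemma eval_Var t : eval (M := term_model) Var t = t.
Proof. by elim: t => //= [t ->|t -> u ->|t -> u ->]. Qed.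

(* Witnesses exceed every variable of their formula, bound ones included, so
   [All x (x <> t)] yields variables equal to t beyond any given bound; this
   makes renaming of bound variables unnecessary. *)
Lemma term_eqv_fresh n t : exists2 z, n <= z & term_eqv (Var z) t.
Proof.
pose x := maxn n (tbound t).
have xt u : tsubst x u t = t by rewrite tsubst_bound // leq_maxr.
have [|z [zb rz]] := @refuted_all x (Neq (Var x) t).
  apply: contrapT => /refuted_neg /= r.
  have := refuted_ex (isT : free_for x t (Eq (Var x) t)) r.
  by rewrite /= eqxx xt; apply: term_eqv_refl.
exists z; first by move: zb; rewrite /= /x; lia.
by move: rz; rewrite /= eqxx xt => /(refuted_neg (Eq (Var z) t)).
Qed.

(** The hypothesis speaks of sizes because it is used for instances of [g]. An arbitrary term is
    traded for an equal variable beyond [fbound g], which cannot be captured. *)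
Lemma truth_all y g :
  (forall h, fsize h <= fsize g -> sat (M := term_model) Var h <-> ~ refuted h) ->
  sat (M := term_model) Var (All y g) <-> ~ refuted (All y g).
Proof.
move=> IH; split.
  move=> /= sg /refuted_all[z [/=]]; rewrite geq_max => /andP[_ gz] rg.
  have : sat (M := term_model) Var (subst y (Var z) g).
    by apply/sat_subst; [exact: fbound_free_for|apply: sg].
  by rewrite IH ?fsize_subst.
move=> /refuted_neg /= rg t.
have [z gz zt] := term_eqv_fresh (fbound g) t.
have fz : free_for y (Var z) g by apply: fbound_free_for.
have := refuted_ex (t := Var z) _ rg; rewrite free_for_neg => /(_ fz).
rewrite -neg_subst => /refuted_neg; rewrite -IH ?fsize_subst // => /(sat_subst _ fz).
apply: sat_eqv_sub => x _ /=; rewrite /upd; case: eqP => // _.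
exact: (eqv_refl (s := term_model)).
Qed.

Lemma truth f : sat (M := term_model) Var f <-> ~ refuted f.
Proof.
(* By De Morgan duality the cases of [Or] and [Ex] reduce to those of [And] and [All]. *)
have dual h : (sat (M := term_model) Var (neg h) <-> ~ refuted (neg h)) ->
    sat (M := term_model) Var h <-> ~ refuted h.
  by rewrite sat_neg refuted_neg notK => H; rewrite -[sat _ _]notK H.
have [n] := ubnP (fsize f); elim: n f => // n IH f.
have IHand h k : fsize h + fsize k < n ->
    sat (M := term_model) Var (And h k) <-> ~ refuted (And h k).
  by move=> szhk; rewrite refuted_and not_orE /= !IH //; lia.
have IHall y h : fsize h < n ->
    sat (M := term_model) Var (All y h) <-> ~ refuted (All y h).
  by move=> szh; apply: truth_all => k kh; apply: IH; lia.
case: f => [t u|t u|f g|f g|y f|y f] szf.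
- by rewrite /= !eval_Var.
- by rewrite /= !eval_Var -[Neq t u]/(neg (Eq t u)) refuted_neg.
- exact: IHand.
- by apply: dual; apply: IHand; rewrite !fsize_neg.
- exact: IHall.
- by apply: dual; apply: IHall; rewrite fsize_neg.
Qed.

Lemma henkin_countermodel : exists (M : structure) (rho : nat -> M),
  (forall f r, T f -> sat (M := M) r f) /\ falsifies rho G0.
Proof.
exists term_model, Var; split.
  move=> f r Tf; apply: (@sat_closed _ (Var : nat -> term_model)); first exact: T_closed.
  apply/truth => rf; apply: (@refuted_underivable (f +` mset0)); last exact: FOL_thy.
  by move=> h; rewrite in_mset1D in_mset0 orbF => /eqP->.
by move=> f fG /truth; apply; exists 0.
Qed.

End Henkin.

Lemma completeness (T : formula -> Prop) (G : sequent) :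
  (forall f, T f -> fv f = [::]) ->
  (forall (M : structure) (rho : nat -> M),
     (forall f r, T f -> sat (M := M) r f) -> ~ falsifies rho G) ->
  FOL T G.
Proof.
move=> Tc valid; apply: contrapT => nG.
have surj f : exists n, choice.unpickle n = Some (f : formula).
  by exists (choice.pickle f); rewrite choice.pickleK.
have [M [rho [MT fG]]] := henkin_countermodel Tc nG surj.
exact: (valid M rho).
Qed.

(** * Rules determined by their sequents *)

(* Regularity compares sequents only, so isomorphic subtrees may apply different
   rules. The rules that matter for the branch condition, (case) and
   non-vacuous (forall), are nevertheless determined by the sequents. *)

Definition weight (G : sequent) : nat := \sum_(f <- enum_mset G) fsize f.

Lemma perm_mset1D f (G : sequent) : perm_eq (f +` G) (f :: enum_mset G).
Proof.
rewrite -[f +` G]seq_mset_id; apply: perm_trans (perm_eq_seq_mset _) _.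
by apply/eq_seq_msetP; rewrite mset_cons !seq_mset_id.
Qed.

Lemma size_mset1D f (G : sequent) : size (enum_mset (f +` G)) = (size (enum_mset G)).+1.
Proof. by rewrite (perm_size (perm_mset1D f G)). Qed.

Lemma weight1D f G : weight (f +` G) = fsize f + weight G.
Proof. by rewrite /weight (perm_big _ (perm_mset1D f G)) big_cons. Qed.

Lemma size_ssubst y t (G : sequent) : size (enum_mset (ssubst y t G)) = size (enum_mset G).
Proof. by rewrite /ssubst (perm_size (perm_eq_seq_mset _)) size_map. Qed.

Lemma weight_ssubst y t (G : sequent) : weight (ssubst y t G) = weight G.
Proof.
rewrite /weight /ssubst (perm_big _ (perm_eq_seq_mset _)) big_map.
by apply: eq_bigr => f _; rewrite fsize_subst.
Qed.

(** The left premiss identifies the rule: (and) lowers the weight, (cut) adds a formula, (case)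
    changes neither. *)
Lemma SQ_two_premisses r p q G : SQ r [:: p; q] G ->
  [\/ exists y, [/\ r = Case y, in_fv y G & p = ssubst y Zero G],
      weight p < weight G | size (enum_mset G) < size (enum_mset p)].
Proof.
move Eps: [:: p; q] => ps H; case: H Eps => // {r ps G}.
- by move=> G f g [-> _]; apply: Or32; rewrite !weight1D /=; lia.
- by move=> G y yG [-> _]; apply: Or31; exists y.
- by move=> G f [-> _]; apply: Or33; rewrite size_mset1D.
Qed.

(** Read upwards, (weak) only removes formulas, (forall) keeps their number and frees at most its
    active variable, and every other rule adds a formula. *)
Lemma SQ_one_premiss r p G : SQ r [:: p] G ->
  [\/ exists z, [/\ r = RAll z, ~ in_fv z G, size (enum_mset p) = size (enum_mset G) &
        forall x, in_fv x p -> x = z \/ in_fv x G],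
      {subset p <= G} | size (enum_mset G) < size (enum_mset p)].
Proof.
move Eps: [:: p] => ps H; case: H Eps => // {r ps G}.
- by move=> G f g [->]; apply: Or33; rewrite !size_mset1D.
- move=> G y z f zG fz [->]; apply: Or31; exists z; split=> //.
    by rewrite !size_mset1D.
  move=> x [h]; rewrite in_mset1D => /orP[/eqP->|hG xh]; last first.
    by right; exists h; rewrite // in_mset1D hG orbT.
  move/fv_substS => /orP[|/andP[xy xf]]; first by rewrite inE => /eqP; left.
  by right; exists (All y f); rewrite ?in_mset1D ?eqxx // mem_filter /= xy.
- by move=> G y t f _ [->]; apply: Or33; rewrite !size_mset1D.
- by move=> G t [->]; apply: Or33; rewrite !size_mset1D.
- by move=> G y t0 t1 u0 u1 [->]; apply: Or33; rewrite !size_mset1D.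
- by move=> G t [->]; apply: Or33; rewrite !size_mset1D.
- by move=> G t u [->]; apply: Or33; rewrite !size_mset1D.
- by move=> G t [->]; apply: Or33; rewrite !size_mset1D.
- by move=> G t u [->]; apply: Or33; rewrite !size_mset1D.
- by move=> G t0 t1 [->]; apply: Or33; rewrite !size_mset1D.
- by move=> G D [->]; apply: Or32 => f fG; rewrite in_msetD fG.
Qed.

(** Substituting 0 removes the active variable and keeps every other free variable, so the left
    premiss reveals it. *)
Lemma SQ_case_unique y r ps G : SQ (Case y) ps G -> SQ r ps G -> r = Case y.
Proof.
move Er: (Case y) => r0 H; case: H Er => // {r0 ps}G x yG _.
move=> /SQ_two_premisses[[z [-> [f fG zf] E]]||]; rewrite ?weight_ssubst ?size_ssubst ?ltnn //.
have [->//|zy] := eqVneq z x.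
have : subst x Zero f \in ssubst z Zero G by rewrite -E; apply: mem_ssubst.
case/ssubst_mem => g _ /(congr1 fv) E'.
by have := mem_fv_subst Zero zy zf; rewrite E' (negPf (fv_subst_closed _ _ _)).
Qed.

(** A free variable of the premiss that the conclusion lacks excludes (weak) and can only be the
    active variable of a (forall). *)
Lemma SQ_all_unique z r ps i p G :
  SQ (RAll z) ps G -> onth ps i = Some p -> in_fv z p -> SQ r ps G -> r = RAll z.
Proof.
move=> H; have [q Eps] : exists q, ps = [:: q].
  by move Er: (RAll z) H => r0 H; case: H Er => // ? ? ? ? ? ? _; eexists.
rewrite {}Eps in H *; case: i => [|i] /=; last by rewrite onth0n.
case=> <- {p} zq rq.
have [zG sz] : ~ in_fv z G /\ size (enum_mset q) = size (enum_mset G).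
  move: H; move Er: (RAll z) => r0; move Eps: [:: q] => ps0 H.
  case: H Er Eps => // D y x f xG _ [->] [->]; split=> //.
  by rewrite !size_mset1D.
case/SQ_one_premiss: rq => [[x [-> _ _ H1]]|sub|]; last by rewrite sz ltnn.
  by case: (H1 z zq) => [->//|/zG].
by case: zG; case: zq => f fq zf; exists f => //; apply: sub.
Qed.

(** * Local soundness *)

Lemma falsifies1D (M : structure) (rho : nat -> M) f G :
  falsifies rho (f +` G) <-> ~ sat rho f /\ falsifies rho G.
Proof.
split=> [H|[nf H] g].
  by split=> [|g gG]; apply: H; rewrite in_mset1D ?eqxx ?gG ?orbT.
by rewrite in_mset1D => /orP[/eqP->|/H].
Qed.

Lemma falsifies_ext (M : structure) (rho rho' : nat -> M) (G : sequent) :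
  (forall x, in_fv x G -> rho x = rho' x) -> falsifies rho G -> falsifies rho' G.
Proof.
move=> E nG f fG sf; apply: (nG f fG); apply: sat_eqv_sub sf => x xf.
by rewrite E; [apply: eqv_refl|exists f].
Qed.

Lemma upd_upd (D : Type) (rho : nat -> D) y c d x : upd (upd rho y c) y d x = upd rho y d x.
Proof. by rewrite /upd; case: eqP. Qed.

Lemma upd_same (D : Type) (rho : nat -> D) y d : upd rho y d y = d.
Proof. by rewrite /upd eqxx. Qed.

Section Model.
Variable M : structure.
Hypothesis M_PA : forall f (r : nat -> M), PA f -> sat r f.

Lemma sat_Q (r : nat -> M) f : f \in Q_matrices -> sat r f.
Proof. by move=> fQ; apply: sat_uclosure; apply: M_PA; apply: PA_robinson. Qed.

Let val2 (a b : M) : nat -> M := fun x => if x == 0 then a else b.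

Lemma M_succ_neq0 (a : M) : ~ eqv (succ a) zero.
Proof. by have := @sat_Q (val2 a a) (nth (Eq Zero Zero) Q_matrices 0) isT. Qed.

Lemma M_succ_inj (a b : M) : eqv (succ a) (succ b) -> eqv a b.
Proof. by have [|//] := @sat_Q (val2 a b) (nth (Eq Zero Zero) Q_matrices 1) isT. Qed.

Lemma M_cases (a : M) : eqv a zero \/ exists b, eqv a (succ b).
Proof. exact: (@sat_Q (val2 a a) (nth (Eq Zero Zero) Q_matrices 2) isT). Qed.

Lemma M_add0 (a : M) : eqv (plus a zero) a.
Proof. exact: (@sat_Q (val2 a a) (nth (Eq Zero Zero) Q_matrices 3) isT). Qed.

Lemma M_addS (a b : M) : eqv (plus a (succ b)) (succ (plus a b)).
Proof. exact: (@sat_Q (val2 a b) (nth (Eq Zero Zero) Q_matrices 4) isT). Qed.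

Lemma M_mult0 (a : M) : eqv (mult a zero) zero.
Proof. exact: (@sat_Q (val2 a a) (nth (Eq Zero Zero) Q_matrices 5) isT). Qed.

Lemma M_multS (a b : M) : eqv (mult a (succ b)) (plus (mult a b) a).
Proof. exact: (@sat_Q (val2 a b) (nth (Eq Zero Zero) Q_matrices 6) isT). Qed.

Lemma M_induction (rho : nat -> M) x f :
  sat (upd rho x zero) f ->
  (forall d, sat (upd rho x d) f -> sat (upd rho x (succ d)) f) ->
  forall d, sat (upd rho x d) f.
Proof.
move=> f0 fS; have := M_PA rho (PA_induction x f); move=> /sat_uclosure.
rewrite /induction_axiom /imp; set A := And _ _.
suff sA : sat rho A by case=> // /(sat_neg rho A).
split.
  by apply/sat_subst => //; apply: free_for_self.
move=> d; have [fd|nfd] := pselect (sat (upd rho x d) f); [right|by left; apply/sat_neg].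
apply/sat_subst; first by apply: free_for_self => z; rewrite inE.
by apply: sat_eqv_sub (fS d fd) => z _; rewrite /= upd_upd upd_same; apply: eqv_refl.
Qed.

(** Minimality refers to immediate predecessors. If no such [c] existed, the complement would
    contain zero and be closed under successor, hence be everything by induction. *)
Lemma M_least (rho : nat -> M) x f d : sat (upd rho x d) f ->
  exists2 c, sat (upd rho x c) f & forall e, eqv (succ e) c -> ~ sat (upd rho x e) f.
Proof.
move=> fd; apply: contrapT => nmin.
have desc c : sat (upd rho x c) f -> exists2 e, eqv (succ e) c & sat (upd rho x e) f.
  move=> fc; apply: contrapT => nc; apply: nmin; exists c => // e ec fe.
  by apply: nc; exists e.
suff /(_ d)/sat_neg : forall c, sat (upd rho x c) (neg f) by [].
apply: M_induction => [|c /sat_neg nc]; apply/sat_neg => /desc[e ec fe].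
  exact: M_succ_neq0 ec.
apply: nc; apply: sat_eqv_sub fe => z _; rewrite /upd.
by case: eqP => _; [apply: M_succ_inj|apply: eqv_refl].
Qed.

(** Validity of the rules in [M], read upwards. The valuation is tracked because the descent needs
    values to stay fixed away from (forall) and right premisses of (case). *)
Lemma SQ_local_sound r ps G (rho : nat -> M) : SQ r ps G -> falsifies rho G ->
  exists i p rho', [/\ onth ps i = Some p, falsifies rho' p,
    forall y, ~ (r = RAll y /\ in_fv y p) -> ~ (r = Case y /\ i = 1) -> rho' y = rho y
    & forall y, r = Case y -> i = 1 -> eqv (succ (rho' y)) (rho y)].
Proof.
have eqvN (a b : M) : ~ ~ eqv a b -> eqv a b by move/contrapT.
have same i p : onth ps i = Some p -> falsifies rho p -> (forall y, r <> Case y) ->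
    exists i p rho', [/\ onth ps i = Some p, falsifies rho' p,
    forall y, ~ (r = RAll y /\ in_fv y p) -> ~ (r = Case y /\ i = 1) -> rho' y = rho y
    & forall y, r = Case y -> i = 1 -> eqv (succ (rho' y)) (rho y)].
  by move=> ip np rC; exists i, p, rho; split=> // y /rC.
move=> H; case: H same => {r ps G}.
- by move=> G t0 t1 _ /falsifies1D[nt /falsifies1D[/eqvN]].
- by move=> G t _ /falsifies1D[/eqvN/M_succ_neq0].
- move=> G f g same /falsifies1D[nfg nG].
  have [sf|nf] := pselect (sat rho f); last by apply: (same 0) => //; apply/falsifies1D.
  by apply: (same 1) => //; apply/falsifies1D; split=> // sg; apply: nfg.
- move=> G f g same /falsifies1D[nfg nG]; apply: (same 0) => //.
  apply/falsifies1D; split=> [sf|]; first by apply: nfg; left.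
  by apply/falsifies1D; split=> // sg; apply: nfg; right.
- move=> G y z f zG fz _ /falsifies1D[/existsNP[d nfd] nG].
  have nP : falsifies (upd rho z d) (subst y (Var z) f +` G).
    apply/falsifies1D; split.
      rewrite sat_subst // => sf; apply: nfd; apply: sat_eqv_sub sf => x xf.
      rewrite /= upd_same /upd; case: (eqVneq x y) => xy; first exact: eqv_refl.
      case: eqP => [xz|_]; last exact: eqv_refl.
      by case: zG; exists (All y f); rewrite ?in_mset1D ?eqxx //= mem_filter /= -xz xy.
    apply: falsifies_ext nG => x xG; rewrite /upd; case: eqP => // xz; case: zG.
    by case: xG => h hG xh; exists h; rewrite ?in_mset1D ?hG ?orbT // -xz.
  (* If [z] is not free in the premiss, the old valuation still falsifies it, so a vacuous (forall)
     changes nothing. *)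
  have [zp|zp] := pselect (in_fv z (subst y (Var z) f +` G)).
    exists 0, (subst y (Var z) f +` G), (upd rho z d); split=> // x nx _.
    by rewrite /upd; case: eqP => // xz; case: nx; rewrite xz.
  exists 0, (subst y (Var z) f +` G), rho; split=> //.
  by apply: falsifies_ext nP => x; rewrite /upd; case: eqP => // -> /zp.
- move=> G y t f ft same /[dup] nG /falsifies1D[nf _]; apply: (same 0) => //.
  apply/falsifies1D; split=> //; rewrite sat_subst // => sf; apply: nf.
  by exists (eval rho t).
- move=> G t same nG; apply: (same 0) => //; apply/falsifies1D; split=> //.
  by apply; apply: eqv_refl.
- move=> G y t0 t1 u0 u1 same /falsifies1D[/eqvN t01 /falsifies1D[/= /eqvN u01 nG]].
  apply: (same 0) => //; apply/falsifies1D; split=> /=; first by apply.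
  apply/falsifies1D; split; first by apply.
  apply/falsifies1D; split=> //; apply.
  have := u01; rewrite !eval_tsubst; apply: (@sat_eqv_sub _ _ _ (Eq u0 u1)) => x _.
  by rewrite /upd; case: eqP => // _; apply: eqv_refl.
- move=> G t same nG; apply: (same 0) => //; apply/falsifies1D; split=> //.
  by apply; apply: M_add0.
- move=> G t u same nG; apply: (same 0) => //; apply/falsifies1D; split=> //.
  by apply; apply: M_addS.
- move=> G t same nG; apply: (same 0) => //; apply/falsifies1D; split=> //.
  by apply; apply: M_mult0.
- move=> G t u same nG; apply: (same 0) => //; apply/falsifies1D; split=> //.
  by apply; apply: M_multS.
- move=> G t0 t1 same /falsifies1D[/eqvN t01 nG]; apply: (same 0) => //.
  apply/falsifies1D; split; first by apply.
  by apply/falsifies1D; split=> //; apply; apply: M_succ_inj.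
- move=> G y yG _ nG.
  have nS t (r : nat -> M) : {subset tfv t <= [:: y]} ->
      (forall x, eqv (upd r y (eval r t) x) (rho x)) -> falsifies r (ssubst y t G).
    move=> ty E _ /ssubst_mem[g gG ->]; rewrite sat_subst ?free_for_self // => sg.
    by apply: (nG g gG); apply: sat_eqv_sub sg => x _.
  (* The value of [y] selects the premiss; in the successor case [y] moves to a predecessor. *)
  case: (M_cases (rho y)) => [y0|[e ye]].
    exists 0, (ssubst y Zero G), rho; split=> //; apply: nS => // x.
    by rewrite /upd; case: eqP => [->|_]; [apply: eqv_sym|apply: eqv_refl].
  exists 1, (ssubst y (Succ (Var y)) G), (upd rho y e); split=> //.
  + apply: nS => [z|x]; first by rewrite inE.
    rewrite upd_upd /= upd_same /upd.
    by case: eqP => [->|_]; [apply: eqv_sym|apply: eqv_refl].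
  + move=> x _ nx; rewrite /upd; case: eqP => // xy; case: nx.
    by rewrite xy.
  + by move=> x [<-] _; rewrite upd_same; apply: eqv_sym.
- move=> G D same nG; apply: (same 0) => // f fG; apply: nG.
  by rewrite in_msetD fG.
- move=> G f same nG; have [sf|nf] := pselect (sat rho f).
    by apply: (same 1) => //; apply/falsifies1D; split=> // /sat_neg.
  by apply: (same 0) => //; apply/falsifies1D.
Qed.

End Model.

(** * The graph of subtree classes *)

Section Graph.
Variables (P : tree) (V : finType) (addr : V -> seq nat).
Hypothesis P_correct : locally_correct P.
Hypothesis P_branch : forall b, infinite_branch P b -> exists N, good_tail P b N.

(** A child of a representative is replaced by the representative of its class, so cycles of the
    graph stand for infinite branches of [P]. *)
Definition edge (v : V) (i : nat) (w : V) : Prop :=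
  P (rcons (addr v) i) <> None /\ subtree_iso P (rcons (addr v) i) (addr w).

Definition right_case (v : V) (i y : nat) : Prop :=
  rule_at P (addr v) = Some (Case y) /\ i = 1.

(* A vacuous (forall) with active variable y imposes no change of the value
   of y, hence the second clause. *)
Definition disturbs (v : V) (y : nat) : Prop :=
  rule_at P (addr v) = Some (RAll y) /\
  exists i p, sequent_at P (rcons (addr v) i) = Some p /\ in_fv y p.

Lemma prefix_node a c : P (a ++ c) <> None -> P a <> None.
Proof.
move=> Pac Pa; apply: Pac; elim/last_ind: c => [|c i IH]; first by rewrite cats0.
by have := P_correct (a ++ c); rewrite IH -rcons_cat => ->.
Qed.

Lemma iso_node a a' : subtree_iso P a a' -> P a <> None -> P a' <> None.
Proof.
move/(_ [::]); rewrite !cats0 /sequent_at.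
by case: (P a) => //; case: (P a').
Qed.

(** Isomorphic nodes share conclusion and premisses but perhaps not the rule; this form feeds the
    uniqueness lemmas for (case) and (forall). *)
Lemma iso_rules a a' : subtree_iso P a a' -> P a <> None ->
  exists G ps r r', [/\ rule_at P a = Some r, rule_at P a' = Some r', SQ r ps G, SQ r' ps G
    & forall i, sequent_at P (rcons a' i) = onth ps i].
Proof.
move=> iso Pa; have Pa' := iso_node iso Pa; rewrite /rule_at.
have := iso [::]; rewrite !cats0 /sequent_at.
have := P_correct a; have := P_correct a'.
case: (P a') Pa' => [[G' r']|] // _; case: (P a) Pa => [[G r]|] // _.
move=> [ps' r'ps' E'] [ps rps E] /= [GG']; exists G, ps, r, r'.
have psE : ps = ps'.
  by apply: eq_from_onth => i; rewrite -E -E' -!cats1; apply: iso.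
by split=> //; rewrite ?GG' ?psE.
Qed.

Lemma iso_case a v y : subtree_iso P a (addr v) -> P a <> None ->
  rule_at P a = Some (Case y) -> rule_at P (addr v) = Some (Case y).
Proof.
move=> iso Pa; have [G [ps [r [r' [-> -> rG r'G _]]]]] := iso_rules iso Pa => -[rE].
by rewrite rE in rG; rewrite (SQ_case_unique rG r'G).
Qed.

(** Turns a disturbance seen in the graph into a (forall) on an actual branch, where the branch
    condition can forbid it. *)
Lemma iso_disturbs a v y : subtree_iso P a (addr v) -> P a <> None ->
  disturbs v y -> rule_at P a = Some (RAll y).
Proof.
move=> iso Pa; rewrite /disturbs.
have [G [ps [r [r' [-> -> rG r'G ip]]]]] := iso_rules iso Pa => -[[rE] [i [p [pE yp]]]].
rewrite rE in r'G; rewrite ip in pE.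
by rewrite (SQ_all_unique r'G pE yp rG).
Qed.

(** The same premiss numbers are followed in [P] below [addr v0]. The addresses reached need not be
    the representatives, but the subtrees there are isomorphic. *)
Lemma edge_walk v0 (s : nat -> V) (b : nat -> nat) : P (addr v0) <> None -> s 0 = v0 ->
  (forall n, edge (s n) (b n) (s n.+1)) ->
  forall n, P (addr v0 ++ mkseq b n) <> None /\
    subtree_iso P (addr v0 ++ mkseq b n) (addr (s n)).
Proof.
move=> P0 s0 E; elim=> [|n [Pn iso]].
  by rewrite cats0 s0; split=> // c.
have [Pe isoe] := E n.
have -> : addr v0 ++ mkseq b n.+1 = rcons (addr v0 ++ mkseq b n) (b n).
  by rewrite mkseqS rcons_cat.
have isor : subtree_iso P (rcons (addr v0 ++ mkseq b n) (b n)) (rcons (addr (s n)) (b n)).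
  by move=> c; rewrite !cat_rcons; apply: iso.
split; last by move=> c; rewrite isor isoe.
by apply: iso_node Pe => c; rewrite isor.
Qed.

(** * Progress in a terminal component *)

Section Component.
Variables (B : pred V) (E : V -> nat -> V -> Prop) (v1 : V).
Hypothesis E_edge : forall v i w, E v i w -> edge v i w.
Hypothesis E_B : forall v i w, E v i w -> B w.
Hypothesis B_node : forall v, B v -> P (addr v) <> None.
Hypothesis B_succ : forall v, B v -> exists i w, E v i w.
Hypothesis B_v1 : B v1.

Let e : rel V := fun v w => `[< exists i, E v i w >].

Lemma connect_B v w : B v -> connect e v w -> B w.
Proof.
move=> Bv /connectP[p ep ->]; elim: p v Bv ep => //= u p IH v Bv /andP[/asboolP[i vu]].
by apply: IH; apply: E_B vu.
Qed.

(** A vertex of [B] that reaches the fewest vertices works: whatever it reaches cannot reach fewer,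
    hence reaches it back. *)
Lemma terminal_component : exists2 v0, B v0 & forall u, connect e v0 u -> connect e u v0.
Proof.
have [v0 Bv0 min] := arg_minnP (fun v => #|connect e v|) B_v1.
exists v0 => // u v0u; have Bu := connect_B Bv0 v0u.
have sub : connect e u \subset connect e v0.
  by apply/subsetP => w; apply: connect_trans.
have : connect e v0 \subset connect e u.
  by rewrite -(geq_leqif (subset_leqif_card sub)) min.
by move=> /subsetP/(_ v0); apply; apply: connect0.
Qed.

(** Loops through [v0], one for each vertex of the component, are concatenated. *)
Lemma covering_cycle v0 : B v0 -> (forall u, connect e v0 u -> connect e u v0) ->
  exists p, [/\ path e v0 p, last v0 p = v0, p != [::] &
    forall u, connect e v0 u -> u \in v0 :: p].
Proof.
move=> Bv0 term.
have loop u : connect e v0 u -> exists p, [/\ path e v0 p, last v0 p = v0 & u \in v0 :: p].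
  move=> /[dup] v0u /term /connectP[q eq ql]; case/connectP: v0u => p ep pl.
  exists (p ++ q); rewrite cat_path last_cat -pl ep -ql eq; split=> //.
  by rewrite -cat_cons mem_cat pl mem_last.
(* An edge out of [v0] and a return keep the cycle nonempty even if [v0] is alone in its
   component. *)
have [i [w v0w]] := B_succ Bv0.
have ev0w : e v0 w by apply/asboolP; exists i.
have [q eq ql] := connectP (term w (connect1 ev0w)).
suff [p [ep pl pu]] : exists p, [/\ path e v0 p, last v0 p = v0 &
    forall u, u \in enum (connect e v0) -> u \in v0 :: p].
  exists (p ++ w :: q); rewrite cat_path last_cat pl ep /= ev0w eq -ql; split=> //.
    by case: (p).
  by move=> u v0u; rewrite -cat_cons mem_cat pu // mem_enum.
have : {subset enum (connect e v0) <= connect e v0} by move=> u; rewrite mem_enum.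
elim: (enum _) => [|u us IH] sub; first by exists [::].
have [|p [ep pl pu]] := IH; first by move=> x xu; apply: sub; rewrite inE xu orbT.
have [|r [er rl ru]] := loop u; first by apply: sub; rewrite inE eqxx.
exists (p ++ r); rewrite cat_path last_cat pl ep er rl; split=> // x.
rewrite inE => /orP[/eqP->|/pu].
  by move: ru; rewrite !inE mem_cat => /orP[->|->]; rewrite ?orbT.
by rewrite !inE mem_cat => /orP[->|->]; rewrite ?orbT.
Qed.

Lemma cycle_walk v0 p : path e v0 p -> last v0 p = v0 -> p != [::] ->
  exists s b, [/\ s 0 = v0, forall n, E (s n) (b n) (s n.+1),
    forall n, connect e v0 (s n) &
    forall u N, u \in v0 :: p -> exists2 n, N <= n & s n = u].
Proof.
move=> ep pl p0; have m0 : 0 < size p by case: (p) p0.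
(* Since [p] ends in [v0], reading [v0 :: p] modulo [size p] runs round the cycle for ever. *)
pose s n := nth v0 (v0 :: p) (n %% size p).
have step n : e (s n) (s n.+1).
  have nm := ltn_pmod n m0.
  suff <- : nth v0 p (n %% size p) = s n.+1 by apply: (pathP v0 ep).
  rewrite /s -addn1 -modnDml addn1.
  move: nm; rewrite leq_eqVlt => /orP[/eqP nm|nm]; last by rewrite (modn_small nm).
  by rewrite nm modnn /= -[RHS]pl (last_nth v0) -[X in _ = nth _ _ X]nm.
have /choice[b bE] n : exists i, E (s n) i (s n.+1) by apply/asboolP/step.
exists s, b; split=> //; first by rewrite /s mod0n.
  by elim=> [|n IH]; [rewrite /s mod0n|apply: connect_trans IH (connect1 (step n))].
move=> u N up; have [k km <-] : exists2 k, k < size p & nth v0 (v0 :: p) k = u.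
  have [->|uv0] := eqVneq u v0; first by exists 0.
  have iu : index u (v0 :: p) <= size p by rewrite -ltnS index_mem.
  move: iu; rewrite leq_eqVlt => /orP[/eqP iu|iu]; last first.
    by exists (index u (v0 :: p)); rewrite ?nth_index.
  by have := nth_index v0 up; rewrite iu -last_nth pl => /esym/eqP; rewrite (negPf uv0).
exists (N * size p + k); first by nia.
by rewrite /s modnMDl modn_small.
Qed.

Lemma progress_component : exists (A : pred V) (y : nat),
  [/\ exists v, A v, forall v, A v -> B v, forall v i w, A v -> E v i w -> A w,
      exists v i w, [/\ A v, E v i w & right_case v i y]
    & forall v, A v -> ~ disturbs v y].
Proof.
have [v0 Bv0 term] := terminal_component.
have [p [ep pl p0 pu]] := covering_cycle Bv0 term.
have [s [b [s0 sE sA visit]]] := cycle_walk ep pl p0.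
have walk := edge_walk (B_node Bv0) s0 (fun n => E_edge (sE n)).
pose l := size (addr v0).
(* The branch descends to [addr v0] and then follows the walk, with [l] as offset between the two
   numberings. *)
pose br n := if n < l then nth 0 (addr v0) n else b (n - l).
have brl n : mkseq br (l + n) = addr v0 ++ mkseq b n.
  rewrite /mkseq iotaD map_cat add0n; congr (_ ++ _).
    rewrite -[RHS](mkseq_nth 0); apply/eq_in_map => i.
    by rewrite mem_iota add0n /br => /andP[_ ->].
  rewrite -[X in iota X]addn0 iotaDl -map_comp; apply: eq_map => i /=.
  by rewrite /br ltnNge leq_addr /= addKn.
have inf : infinite_branch P br.
  move=> n; have [ln|nl] := leqP l n.
    by rewrite -(subnKC ln) brl; have [] := walk (n - l).
  apply: (@prefix_node _ (map br (iota n (l - n)))).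
  rewrite /mkseq -map_cat -[X in iota X (l - n)]add0n -iotaD subnKC 1?ltnW //.
  by rewrite -[map _ _]/(mkseq br l) -[l]addn0 brl cats0; apply: B_node.
have [N [_ noall [y right]]] := P_branch inf.
have [n Nn [rn bn]] := right (maxn N l).
have ln : l <= n by lia.
rewrite -(subnKC ln) brl in rn; set k := n - l in rn.
have [Pk isok] := walk k.
exists (connect e v0), y; split.
- by exists v0; apply: connect0.
- by move=> v; apply: connect_B.
- by move=> v i w v0v vw; apply: connect_trans v0v (connect1 _); apply/asboolP; exists i.
- exists (s k), (b k), (s k.+1); split=> //; split; first exact: iso_case rn.
  by rewrite -bn /br ltnNge ln.
(* The walk returns to [v] after the right (case) step at [n]; a disturbance of [y] there would
   violate the branch condition. *)
move=> v /pu/(visit _ n.+1)[m nm sm] dv.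
have [Pm isom] := walk m; rewrite -sm in dv.
apply: (noall n (l + m) y) => //; [lia|lia| |].
  by split=> //; rewrite -(subnKC ln) brl.
by rewrite brl; apply: iso_disturbs dv.
Qed.

End Component.
End Graph.

(** * Descent in a model *)

Fixpoint exs (xs : seq nat) (f : formula) : formula :=
  if xs is x :: xs then Ex x (exs xs f) else f.

Lemma sat_exs (M : structure) (rho : nat -> M) xs f :
  sat rho (exs xs f) <->
  exists2 r : nat -> M, (forall x, x \notin xs -> r x = rho x) & sat r f.
Proof.
elim: xs rho => [|x xs IH] rho /=.
  split=> [sf|[r rE]]; first by exists rho.
  by apply: sat_eqv_sub => x _; rewrite rE //; apply: eqv_refl.
split=> [[d /IH[r rE sf]]|[r rE sf]].
  exists r => // z; rewrite inE negb_or => /andP[zx zxs].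
  by rewrite rE // /upd (negPf zx).
exists (r x); apply/IH; exists r => // z zxs; rewrite /upd.
by case: (eqVneq z x) => [->//|zx]; apply: rE; rewrite inE negb_or zx.
Qed.

Definition conj (fs : seq formula) : formula := foldr And (Eq Zero Zero) fs.
Definition disj (fs : seq formula) : formula := foldr Or (Neq Zero Zero) fs.

Lemma sat_conj (M : structure) (rho : nat -> M) fs :
  sat rho (conj fs) <-> {in fs, forall f, sat rho f}.
Proof.
elim: fs => [|f fs IH] /=; first by split=> // _; apply: eqv_refl.
rewrite IH; split=> [[sf sfs] g|H].
  by rewrite inE => /orP[/eqP->|/sfs].
by split=> [|g gfs]; apply: H; rewrite inE ?eqxx ?gfs ?orbT.
Qed.

Lemma sat_disj (M : structure) (rho : nat -> M) fs :
  sat rho (disj fs) <-> exists2 f, f \in fs & sat rho f.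
Proof.
elim: fs => [|f fs IH] /=.
  by split=> [H|[]//]; case: H; apply: eqv_refl.
rewrite IH; split=> [[sf|[g gfs sg]]|[g]].
- by exists f; rewrite // inE eqxx.
- by exists g; rewrite // inE gfs orbT.
- by rewrite inE => /orP[/eqP->|gfs] sg; [left|right; exists g].
Qed.

Section Descent.
Variable M : structure.
Hypothesis M_PA : forall f (r : nat -> M), PA f -> sat r f.
Variables (P : tree) (V : finType) (addr : V -> seq nat).
Hypothesis P_correct : locally_correct P.
Hypothesis P_branch : forall b, infinite_branch P b -> exists N, good_tail P b N.
Hypothesis addr_cover : forall a, P a <> None -> exists v, subtree_iso P a (addr v).

Definition bad (v : V) (rho : nat -> M) : Prop :=
  exists2 G, sequent_at P (addr v) = Some G & falsifies rho G.

Lemma bad_node v rho : bad v rho -> P (addr v) <> None.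
Proof. by case=> G; rewrite /sequent_at; case: (P (addr v)). Qed.

Lemma bad_successor v rho : bad v rho -> exists i w rho',
  [/\ edge P addr v i w, bad w rho',
      forall y, ~ disturbs P addr v y -> ~ right_case P addr v i y -> rho' y = rho y
    & forall y, right_case P addr v i y -> eqv (succ (rho' y)) (rho y)].
Proof.
case=> G GE nG; have := P_correct (addr v); move: GE.
rewrite /sequent_at; case Ev: (P (addr v)) => [[G' r]|] //= [->] [ps rG kids].
have [i [p [rho' [ip np same case]]]] := SQ_local_sound M_PA rG nG.
have pE : sequent_at P (rcons (addr v) i) = Some p by rewrite -ip; apply: kids.
have Pi : P (rcons (addr v) i) <> None.
  by move: pE; rewrite /sequent_at; case: (P _).
have [w iso] := addr_cover Pi.
have vr : rule_at P (addr v) = Some r by rewrite /rule_at Ev.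
exists i, w, rho'; split=> //.
- by exists p => //; have := iso [::]; rewrite !cats0 => <-.
- move=> y nd nr; apply: same => [[rE yp]|[rE i1]].
    by apply: nd; split; [rewrite vr rE|exists i, p].
  by apply: nr; split; rewrite ?vr ?rE.
- by move=> y [+ i1]; rewrite vr => -[rE]; apply: case.
Qed.

(** Falsification at [v] becomes a formula, so that induction in the model applies to it. A missing
    node gets a false formula. *)
Definition falsity (v : V) : formula :=
  if sequent_at P (addr v) is Some G then conj [seq neg f | f <- enum_mset G]
  else Neq Zero Zero.

Lemma sat_falsity v rho : sat rho (falsity v) <-> bad v rho.
Proof.
rewrite /falsity /bad; case: (sequent_at P (addr v)) => [G|].
  rewrite sat_conj; split=> [H|[_ [<-] nG] _ /mapP[f fG ->]]; last exact/sat_neg/nG.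
  by exists G => // f fG; apply/sat_neg; apply: H; apply: map_f.
by split=> [H|[]//]; case: H; apply: eqv_refl.
Qed.

Definition agree (Y : seq nat) (r r' : nat -> M) : Prop := {in Y, r =1 r'}.

(** Finitely many variables occur. Those outside [Y] and other than [y] are quantified away; those
    in [Y] are parameters with values from [rho0]. *)
Lemma bad_definable (A : pred V) Y rho0 y : y \notin Y -> exists f, forall d,
  sat (upd rho0 y d) f <->
  exists v r, [/\ A v, bad v r, agree Y r rho0 & r y = d].
Proof.
move=> yY; pose g := disj [seq falsity v | v <- enum V & A v].
have gE r : sat r g <-> exists2 v, A v & bad v r.
  rewrite sat_disj; split=> [[_ /mapP[v + ->] /sat_falsity bv]|[v Av bv]].
    by rewrite mem_filter => /andP[Av _]; exists v.
  exists (falsity v); last exact/sat_falsity.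
  by apply: map_f; rewrite mem_filter Av mem_enum.
pose xs := [seq x <- fv g | (x \notin Y) && (x != y)].
exists (exs xs g) => d; rewrite sat_exs; split.
  case=> r rE /gE[v Av bv]; exists v, r; split=> //; last first.
    by rewrite rE ?upd_same // mem_filter eqxx andbF.
  move=> x xY; rewrite rE ?mem_filter ?xY // /upd.
  by case: eqP => // xy; rewrite -xy xY in yY.
case=> v [r [Av bv rY ry]].
(* Off the quantified variables the valuation must be that of [upd rho0 y d], so [r] is kept on [xs]
   only. *)
exists (fun x => if x \in xs then r x else upd rho0 y d x); first by move=> x /negPf->.
have : sat r g by apply/gE; exists v.
apply: sat_eqv_sub => x xg.
suff -> : (if x \in xs then r x else upd rho0 y d x) = r x by apply: eqv_refl.
rewrite mem_filter xg andbT /upd; case: (boolP (x \in Y)) => xY /=.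
  by rewrite rY //; case: eqP => // xy; rewrite -xy xY in yY.
by case: (eqVneq x y) => [->|].
Qed.

Definition pending (Y : seq nat) : {set V} :=
  [set v | `[< exists2 y, rule_at P (addr v) = Some (Case y) & y \notin Y >]].

(** The variables in [Y] keep their values from [rho0], and falsification can always be continued
    inside [B]. Each round finds a (case) variable outside [Y] to freeze, which the finite set
    [pending Y] allows only finitely often. *)
Lemma no_bad_node (Y : seq nat) (B : pred V) (rho0 : nat -> M) :
  (exists v rho, [/\ B v, bad v rho & agree Y rho rho0]) ->
  (forall v rho, B v -> bad v rho -> agree Y rho rho0 ->
    exists i w rho',
     [/\ edge P addr v i w /\ B w,
         bad w rho' /\ agree Y rho' rho0,
         forall y, y \in Y -> ~ right_case P addr v i y,
         forall y, ~ disturbs P addr v y -> ~ right_case P addr v i y -> rho' y = rho y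
       & forall y, right_case P addr v i y -> eqv (succ (rho' y)) (rho y)]) ->
  False.
Proof.
have [n] := ubnP #|pending Y|; elim: n Y B rho0 => // n IH Y B rho0 szY.
move=> [v1 [rho1 [Bv1 bv1 ag1]]] inv.
pose B' : pred V := fun v => `[< B v /\ exists2 rho, bad v rho & agree Y rho rho0 >].
pose E v i w := [/\ edge P addr v i w, B' w & forall y, y \in Y -> ~ right_case P addr v i y].
have step v rho : B' v -> bad v rho -> agree Y rho rho0 -> exists i w rho',
     [/\ E v i w,
         bad w rho' /\ agree Y rho' rho0,
         forall y, ~ disturbs P addr v y -> ~ right_case P addr v i y -> rho' y = rho y
       & forall y, right_case P addr v i y -> eqv (succ (rho' y)) (rho y)].
  move=> /asboolP[Bv _] bv ag.
  have [i [w [rho' [[vw Bw] [bw ag'] nY s1 s2]]]] := inv v rho Bv bv ag.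
  by exists i, w, rho'; split=> //; split=> //; apply/asboolP; split=> //; exists rho'.
have [|||v B'v||A [y [[v2 Av2] AB Acl [v3 [i3 [w3 [Av3 E3 rc3]]]] ndist]]] :=
    @progress_component P V addr P_correct P_branch B' E v1.
- by move=> v i w [].
- by move=> v i w [].
- by move=> v /asboolP[_ [rho bv _]]; apply: bad_node bv.
- have /asboolP[_ [rho bv ag]] := B'v.
  by have [i [w [rho' [vw _ _ _]]]] := step v rho B'v bv ag; exists i, w.
- by apply/asboolP; split=> //; exists rho1.
have yY : y \notin Y by apply/negP => yY; case: E3 => _ _ /(_ y yY).
have [f fE] := bad_definable A rho0 yY.
have /asboolP[_ [rho2 bv2 ag2]] := AB v2 Av2.
(* [c] is a value of [y] at a falsified vertex of [A], and no predecessor of [c] is such a value.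
   [rho4] realises [c] and becomes the new reference valuation. *)
have [|c /fE[v4 [rho4 [Av4 bv4 ag4 y4]]] cmin] := @M_least _ M_PA rho0 y f (rho2 y).
  by apply/fE; exists v2, rho2.
apply: (IH (y :: Y) A rho4).
- rewrite -ltnS; apply: leq_trans szY; rewrite ltnS; apply: proper_card.
  rewrite properE; apply/andP; split.
    apply/subsetP => v; rewrite !inE => /asboolP[x vx]; rewrite inE negb_or => /andP[_ xY].
    by apply/asboolP; exists x.
  apply/subsetPn; exists v3; rewrite !inE; case: rc3 => r3 _.
    by apply/asboolP; exists y.
  apply/asboolP => -[x]; rewrite r3 => -[<-].
  by rewrite inE eqxx.
- by exists v4, rho4.
move=> v rho Av bv ag.
have agY : agree Y rho rho0 by move=> x xY; rewrite ag ?ag4 // inE xY orbT.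
have [i [w [rho' [vw [bw ag'] s1 s2]]]] := step v rho (AB v Av) bv agY.
have Aw := Acl _ _ _ Av vw.
(* Such an edge would carry a predecessor of [c] to a falsified vertex of [A]. *)
have nrc : ~ right_case P addr v i y.
  move=> rc; apply: (cmin (rho' y)); last by apply/fE; exists w, rho'.
  by rewrite -y4 -ag ?inE ?eqxx //; apply: s2.
case: vw => vw _ nY; exists i, w, rho'; split=> //.
- split=> // x; rewrite inE => /orP[/eqP->|xY]; last by rewrite ag' // ag4.
  by rewrite s1 //; [apply: ag; rewrite inE eqxx|apply: ndist].
- by move=> x; rewrite inE => /orP[/eqP->|/nY].
Qed.

Lemma regular_sound v rho : ~ bad v rho.
Proof.
move=> bv; apply: (@no_bad_node [::] predT rho); first by exists v, rho.
move=> u r _ bu _; have [i [w [r' [uw bw s1 s2]]]] := bad_successor bu.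
by exists i, w, r'.
Qed.

End Descent.

(** * Soundness of regular proofs and the equivalence *)

Lemma PA_closed f : PA f -> fv f = [::].
Proof. by case=> *; apply: uclosure_closed. Qed.

Lemma RP_sound G : regularly_provable G -> FOL PA G.
Proof.
case=> P [[PG Pc Pb] [reps cover]]; apply: completeness PA_closed _ => M rho M_PA nG.
have P0 : P [::] <> None by move: PG; rewrite /sequent_at; case: (P _).
pose addr (v : 'I_(size reps)) := nth [::] reps v.
have addr_cover a : P a <> None -> exists v, subtree_iso P a (addr v).
  move=> /cover[b br iso]; have ib : index b reps < size reps by rewrite index_mem.
  by exists (Ordinal ib); rewrite /addr /= nth_index.
have [v iso] := addr_cover _ P0.
apply: (regular_sound M_PA Pc Pb addr_cover (v := v) (rho := rho)).
by exists G => //; rewrite -PG; have := iso [::]; rewrite !cats0 => <-.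
Qed.

Theorem corollary5p4 (phi : formula) :
  provable PA phi <->
  exists P : tree, infty_proof P [mset phi]%mset /\ regular P.
Proof. by split; [exact: RP_PA|exact: RP_sound]. Qed.
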